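(* There is an algebra homomorphism $\Psi:{}^{BL}\mathcal H_{\mathbb Z_\sigma}\to\mathbb Z_\sigma(Y)[W^v]$ such that $$\Psi(H_i)=c(\alpha_i^\vee)[r_i]+b(\alpha_i^\vee)[e]\quad(i\in I),\qquad \Psi(Z^\lambda)=e^{-\lambda}\quad(\lambda\in Y),$$ and $\Psi$ is injective.
   Context: $V$ is a finite-dimensional real vector space, $I$ a finite set, $(\alpha_i)_{i\in I}\subset V^*$ and $(\alpha_i^\vee)_{i\in I}\subset V$ are free families such that $(\alpha_j(\alpha_i^\vee))_{i,j\in I}$ is a generalized Cartan matrix. $r_i(v)=v-\alpha_i(v)\alpha_i^\vee$; $W^v=\langle r_i\mid i\in I\rangle\subset GL(V)$ is a Coxeter group with length $\ell$ (it also acts on $V^*$). $\Phi=\{w\alpha_i\}$ (real roots). $Q^\vee=\bigoplus\mathbb Z\alpha_i^\vee$, $Q^\vee_+=\bigoplus\mathbb Z_{\ge0}\alpha_i^\vee$. $Y$ is a discrete subgroup of $V$ with $Q^\vee\subset Y\subset\{v\in V\mid\alpha(v)\in\mathbb Z\ \forall\alpha\in\Phi\}$. $\mathbb Z_\sigma=\mathbb Z[\sigma_i^{\pm1},\sigma_i'^{\pm1}]_{i\in I}$, with indeterminates subject to: $\sigma_i=\sigma'_i$ if $\alpha_i(Y)=\mathbb Z$; $\sigma_i=\sigma_j=\sigma'_i=\sigma'_j$ if $\alpha_i(\alpha_j^\vee)=\alpha_j(\alpha_i^\vee)=-1$. $b(t,u;z)=\frac{(t-t^{-1})+(u-u^{-1})z}{1-z^2}$,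 $c(t,u;z)=t-b(t,u;z)$; $b(\alpha_i^\vee)=b(\sigma_i,\sigma'_i;e^{\alpha_i^\vee})$, $c(\alpha_i^\vee)=c(\sigma_i,\sigma'_i;e^{\alpha_i^\vee})$. The Bernstein-Lusztig-Hecke algebra ${}^{BL}\mathcal H_{\mathbb Z_\sigma}$ is the free $\mathbb Z_\sigma$-module with basis $(Z^\lambda H_w)_{\lambda\in Y,w\in W^v}$ (write $H_w=Z^0H_w$, $H_i=H_{r_i}$, $Z^\lambda=Z^\lambda H_e$), endowed with the unique (known to exist) associative unitary $\mathbb Z_\sigma$-algebra multiplication $*$ with unity $H_e$ such that: (1) $Z^\lambda*H_w=Z^\lambda H_w$; (2) $H_i*H_w=H_{r_iw}$ if $\ell(r_iw)>\ell(w)$, and $H_i*H_w=(\sigma_i-\sigma_i^{-1})H_w+H_{r_iw}$ if $\ell(r_iw)<\ell(w)$; (3) $Z^\lambda*Z^\mu=Z^{\lambda+\mu}$; (4) $H_i*Z^\lambda-Z^{r_i(\lambda)}*H_i=b(\sigma_i,\sigma'_i;Z^{-\alpha_i^\vee})(Z^\lambda-Z^{r_i(\lambda)})$ (the right-hand side being an element of the span of the $Z^\mu$), for all $\lambda,\mu\in Y$, $w\in W^v$, $i\in I$. For $w\in W^v$, $\mathbb Z_\sigma[[Y,-wQ^\vee_+]]$ is the algebra of formal sums $\sum_{y\in Y}a_ye^y$ ($a_y\in\mathbb Z_\sigma$) with support in a finite union of sets $\mu_j-wQ^\vee_+$, $\mu_j\in Y$. $\mathbb Z_\sigma(Y)$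 is the algebra of elements of the fraction field of $\mathbb Z_\sigma[Y]$ which have an expansion in $\mathbb Z_\sigma[[Y,-wQ^\vee_+]]$ for every $w\in W^v$; it contains $b(\alpha_i^\vee)$ and $c(\alpha_i^\vee)$. $\mathbb Z_\sigma(Y)[W^v]$ is the algebra of finite sums $\sum_wf_w[w]$, $f_w\in\mathbb Z_\sigma(Y)$, with multiplication $(\sum_wc_w[w])(\sum_vd_v[v])=\sum_{w,v}c_w({}^wd_v)[wv]$, where ${}^w(e^y)=e^{wy}$. *)

(* Defs.v *)
From HB Require Import structures.
From mathcomp Require Import all_boot all_order all_algebra.
From mathcomp Require Import finmap.
From mathcomp Require Import monalg.
From mathcomp Require Import boolp classical_sets reals topology normedtype.

Set Implicit Arguments.
Unset Strict Implicit.
Unset Printing Implicit Defensive.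

Import Order.TTheory GRing.Theory Num.Theory.
Import numFieldNormedType.Exports.
Local Open Scope ring_scope.

(* An action of G on A by ring automorphisms that fix the image of S. *)
Record ring_action (S : comNzRingType) (G : groupType) (A : comNzRingType) :=
  RingAction {
    ract :> G -> {rmorphism A -> A};
    rbase : {rmorphism S -> A};
    ract1 : forall a, ract 1%g a = a;
    ractM : forall g h a, ract (g * h)%g a = ract g (ract h a);
    ract_base : forall g s, ract g (rbase s) = rbase s
  }.

Definition skew_algebra (S : comNzRingType) (G : groupType) (A : comNzRingType)
  of ring_action S G A : Type := {malg A[G]}.

Section SkewGroupAlgebra.
Context (S : comNzRingType) (G : groupType) (A : comNzRingType).
Context (act : ring_action S G A).
Local Notation skew := (skew_algebra act).

HB.instance Definition _ := GRing.Zmodule.on skew.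

Implicit Types x y z : skew.

Definition skmon (a : A) (g : G) : skew := << a *g g >>.

Definition skone : skew := skmon 1 1%g.

Fact skmul_key : unit. Proof. exact: tt. Qed.

Definition skmul x y : skew := locked_with skmul_key
  (\sum_(g <- msupp x) \sum_(h <- msupp y) skmon (x@_g * act g y@_h) (g * h)%g).

Lemma skmulw (d1 d2 : {fset G}) x y :
  (msupp x `<=` d1)%fset -> (msupp y `<=` d2)%fset ->
  skmul x y =
  \sum_(g <- d1) \sum_(h <- d2) skmon (x@_g * act g y@_h) (g * h)%g.
Proof.
move=> le1 le2; rewrite /skmul locked_withE (big_fset_incl _ le1) /=.
  apply/eq_bigr=> g _; apply/big_fset_incl => // h _ /mcoeff_outdom ->.
  by rewrite rmorph0 mulr0 /skmon monalgU0.
move=> g _ /mcoeff_outdom xg.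
by rewrite big1 => // h _; rewrite xg mul0r /skmon monalgU0.
Qed.

Lemma skmulDl : left_distributive skmul +%R.
Proof.
move=> x1 x2 y; pose d := (msupp x1 `|` msupp x2)%fset.
rewrite (@skmulw d (msupp y) (x1 + x2)) ?msuppD_le //.
rewrite (@skmulw d (msupp y) x1) ?fsubsetUl // (@skmulw d (msupp y) x2) ?fsubsetUr //.
rewrite -big_split /=; apply/eq_bigr=> g _; rewrite -big_split /=.
by apply/eq_bigr=> h _; rewrite mcoeffD mulrDl /skmon monalgUD.
Qed.

Lemma skmulDr : right_distributive skmul +%R.
Proof.
move=> y x1 x2; pose d := (msupp x1 `|` msupp x2)%fset.
rewrite (@skmulw (msupp y) d _ (x1 + x2)) ?msuppD_le //.
rewrite (@skmulw (msupp y) d _ x1) ?fsubsetUl // (@skmulw (msupp y) d _ x2) ?fsubsetUr //.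
rewrite -big_split /=; apply/eq_bigr=> g _; rewrite -big_split /=.
by apply/eq_bigr=> h _; rewrite mcoeffD rmorphD mulrDr /skmon monalgUD.
Qed.

Lemma skmulUU a g b h : skmul (skmon a g) (skmon b h) = skmon (a * act g b) (g * h)%g.
Proof. by rewrite (skmulw msuppU_le msuppU_le) !big_seq_fset1 !mcoeffUU. Qed.

Lemma skmul0l x : skmul 0 x = 0.
Proof. by apply: (addrI (skmul 0 x)); rewrite -skmulDl !addr0. Qed.

Lemma skmul0r x : skmul x 0 = 0.
Proof. by apply: (addrI (skmul x 0)); rewrite -skmulDr !addr0. Qed.

Lemma skew_ind (P : skew -> Prop) :
  (forall a g, P (skmon a g)) -> P 0 -> (forall x y, P x -> P y -> P (x + y)) ->
  forall x, P x.
Proof. by move=> PU P0 PD x; rewrite [x]monalgE; elim/big_ind: _ => // g _; apply: PU. Qed.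

Lemma skmul1l : left_id skone skmul.
Proof.
move=> x; elim/skew_ind: x => [a g||x y IHx IHy].
- by rewrite skmulUU ract1 mul1r mul1g.
- by rewrite skmul0r.
- by rewrite skmulDr IHx IHy.
Qed.

Lemma skmul1r : right_id skone skmul.
Proof.
move=> x; elim/skew_ind: x => [a g||x y IHx IHy].
- by rewrite skmulUU rmorph1 mulr1 mulg1.
- by rewrite skmul0l.
- by rewrite skmulDl IHx IHy.
Qed.

Lemma skmulA : associative skmul.
Proof.
move=> x y z.
elim/skew_ind: x => [a g||x1 x2 IH1 IH2]; last 2 first.
- by rewrite !skmul0l.
- by rewrite !skmulDl IH1 IH2.
elim/skew_ind: y => [b h||x1 x2 IH1 IH2]; last 2 first.
- by rewrite skmul0r !skmul0l skmul0r.
- by rewrite !(skmulDl, skmulDr) IH1 IH2.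
elim/skew_ind: z => [c k||x1 x2 IH1 IH2]; last 2 first.
- by rewrite !skmul0r.
- by rewrite !skmulDr IH1 IH2.
by rewrite !skmulUU rmorphM ractM !mulrA mulgA.
Qed.

Lemma skone_neq0 : skone != 0.
Proof. by rewrite monalgU_eq0 oner_eq0. Qed.

HB.instance Definition _ := GRing.Zmodule_isNzRing.Build skew
  skmulA skmul1l skmul1r skmulDl skmulDr skone_neq0.

Lemma skmonM a g b h : skmon a g * skmon b h = skmon (a * act g b) (g * h)%g.
Proof. exact: skmulUU. Qed.

Definition skscale (s : S) x : skew := skmon (rbase act s) 1%g * x.

Fact skscaleA s t x : skscale s (skscale t x) = skscale (s * t) x.
Proof. by rewrite /skscale mulrA skmonM ract1 mulg1 -rmorphM. Qed.
Fact skscale1 : left_id 1 skscale.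
Proof. by move=> x; rewrite /skscale rmorph1 mul1r. Qed.
Fact skscaleDr : right_distributive skscale +%R.
Proof. by move=> s x y; rewrite /skscale mulrDr. Qed.
Fact skscaleDl x : {morph skscale^~ x : s t / s + t}.
Proof. by move=> s t; rewrite /skscale rmorphD /skmon monalgUD mulrDl. Qed.
HB.instance Definition _ := GRing.Zmodule_isLmodule.Build S skew
  skscaleA skscale1 skscaleDr skscaleDl.

Fact skscaleAl (s : S) x y : s *: (x * y) = (s *: x) * y.
Proof. exact: mulrA. Qed.
HB.instance Definition _ := GRing.Lmodule_isLalgebra.Build S skew skscaleAl.

Lemma skbaseC s x : skmon (rbase act s) 1%g * x = x * skmon (rbase act s) 1%g.
Proof.
elim/skew_ind: x => [a g||x y IHx IHy].
- by rewrite !skmonM ract1 ract_base mul1g mulg1 mulrC.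
- by rewrite mul0r mulr0.
- by rewrite mulrDl mulrDr IHx IHy.
Qed.

Fact skscaleAr (s : S) x y : s *: (x * y) = x * (s *: y).
Proof. by rewrite /GRing.scale /= /skscale mulrA skbaseC -mulrA. Qed.
HB.instance Definition _ := GRing.Lalgebra_isAlgebra.Build S skew skscaleAr.

Lemma skmonDl a b g : skmon (a + b) g = skmon a g + skmon b g.
Proof. exact: monalgUD. Qed.

End SkewGroupAlgebra.

Definition trivial_action (G : groupType) (R : comNzRingType) :
    ring_action R G R :=
  @RingAction R G R (fun _ => idfun) idfun
    (fun _ => erefl) (fun _ _ _ => erefl) (fun _ _ => erefl).

Section GroupAlgebra.
Context (R : comNzRingType) (G : zmodType).

Definition grpalg := skew_algebra (trivial_action (Algebra.to_multiplicative G) R).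
HB.instance Definition _ := GRing.Algebra.on grpalg.

Definition gmon (a : R) (y : G) : grpalg := skmon (trivial_action (Algebra.to_multiplicative G) R) a (y : Algebra.to_multiplicative G).
Definition gcoef (y : G) (p : grpalg) : R := mcoeff (y : Algebra.to_multiplicative G) p.

Lemma gmonM a x b y : gmon a x * gmon b y = gmon (a * b) (x + y).
Proof. exact: (@skmonM _ _ _ (trivial_action (Algebra.to_multiplicative G) R)). Qed.

Lemma gmonDl a b y : gmon (a + b) y = gmon a y + gmon b y.
Proof. exact: skmonDl. Qed.

Lemma grpalg_ind (P : grpalg -> Prop) :
  (forall a g, P (gmon a g)) -> P 0 -> (forall x y, P x -> P y -> P (x + y)) ->
  forall x, P x.
Proof. exact: (@skew_ind _ _ _ (trivial_action (Algebra.to_multiplicative G) R)). Qed.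

Lemma grpalg_mulC : commutative (@GRing.mul grpalg).
Proof.
move=> x y; elim/grpalg_ind: x => [a g||x1 x2 IH1 IH2]; last 2 first.
- by rewrite mul0r mulr0.
- by rewrite mulrDl mulrDr IH1 IH2.
elim/grpalg_ind: y => [b h||x1 x2 IH1 IH2]; last 2 first.
- by rewrite mul0r mulr0.
- by rewrite mulrDl mulrDr IH1 IH2.
by rewrite !gmonM mulrC addrC.
Qed.

HB.instance Definition _ := GRing.PzRing_hasCommutativeMul.Build grpalg grpalg_mulC.

Definition gconst (a : R) : grpalg := gmon a 0.

Fact gconst_zmod : zmod_morphism gconst.
Proof. by move=> a b; exact: monalgUB. Qed.
HB.instance Definition _ := GRing.isZmodMorphism.Build R grpalg gconst gconst_zmod.

Fact gconst_monoid : monoid_morphism gconst.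
Proof. by split=> // a b; rewrite /gconst gmonM addr0. Qed.
HB.instance Definition _ :=
  GRing.isMonoidMorphism.Build R grpalg gconst gconst_monoid.
End GroupAlgebra.

Section GroupAlgebraUnits.
Context (R : comNzRingType) (G : zmodType).
Implicit Types x y : grpalg R G.

Definition grpalg_unit : {pred grpalg R G} := fun x => `[< exists y, y * x = 1 >].

Definition grpalg_inv x :=
  if pselect (exists y, y * x = 1) is left ex then projT1 (cid ex) else x.

Fact grpalg_mulVx : {in grpalg_unit, left_inverse 1 grpalg_inv *%R}.
Proof.
move=> x /asboolP ux; rewrite /grpalg_inv; case: pselect => // ex.
exact: projT2 (cid ex).
Qed.

Fact grpalg_unitPl x y : y * x = 1 -> grpalg_unit x.
Proof. by move=> yx; apply/asboolP; exists y. Qed.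

Fact grpalg_inv_out : {in [predC grpalg_unit], grpalg_inv =1 id}.
Proof.
move=> x /asboolPn ux; rewrite /grpalg_inv; case: pselect => // ex.
Qed.

HB.instance Definition _ := GRing.ComNzRing_hasMulInverse.Build (grpalg R G)
  grpalg_mulVx grpalg_unitPl grpalg_inv_out.
End GroupAlgebraUnits.

(* An abelian group with the positive cone of a translation-invariant linear *)
(* order: its group algebra over an integral domain has no zero divisors. *)
HB.mixin Record Zmodule_hasPosCone G of GRing.Zmodule G := {
  poscone : pred G;
  poscone0 : poscone 0 = false;
  posconeD : forall x y, poscone x -> poscone y -> poscone (x + y);
  poscone_total : forall x, x != 0 -> poscone x || poscone (- x)
}.
#[short(type="linordZmodType")]
HB.structure Definition LinOrdZmodule :=
  { G of Zmodule_hasPosCone G & GRing.Zmodule G }.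

Section GroupAlgebraDomain.
Context (R : idomainType) (G : linordZmodType).

Let lt (x y : G) := poscone (y - x).

Let lt_irr x : lt x x = false.
Proof. by rewrite /lt subrr poscone0. Qed.

Let lt_total x y : x != y -> lt x y || lt y x.
Proof.
move=> xy; rewrite /lt -[x - y]opprB; apply: poscone_total.
by rewrite subr_eq0 eq_sym.
Qed.

Let lt_trans x y z : lt x y -> lt y z -> lt x z.
Proof.
move=> xy yz; have -> : lt x z = poscone ((z - y) + (y - x)).
  by rewrite addrA subrK.
exact: posconeD.
Qed.

Let ltD x y z t : lt x y -> lt z t -> lt (x + z) (y + t).
Proof. by move=> xy zt; rewrite /lt opprD addrACA posconeD. Qed.

Let ltDl x y z : lt y z -> lt (x + y) (x + z).
Proof. by rewrite /lt opprD addrACA subrr add0r. Qed.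

Let max_supp (p : grpalg R G) : p != 0 ->
  exists2 m, gcoef m p != 0 & forall y, gcoef y p != 0 -> y = m \/ lt y m.
Proof.
move=> p0; have [x px] : exists x, gcoef x p != 0.
  apply: contrapT => h; case/eqP: p0; apply/malgP => y; rewrite mcoeff0.
  by apply/eqP; apply: contrapT => /negP py; apply: h; exists y.
have [m ms mmax] : exists2 m, m \in enum_fset (msupp p) &
    forall y, y \in enum_fset (msupp p) -> y = m \/ lt y m.
  have : x \in enum_fset (msupp p) by rewrite -[_ \in _]/(x \in msupp p) -mcoeff_neq0.
  elim: (enum_fset (msupp p)) x {px} => // a s IH x _.
  case: s IH => [_|b s IH]; first by exists a; rewrite ?inE // => y /[!inE] /eqP; left.
  have [|m ms mmax] := IH b; first exact: mem_head.
  have [am|am] := eqVneq a m.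
    exists m; first by rewrite inE ms orbT.
    by move=> y; rewrite inE am => /orP[/eqP|/mmax] //; left.
  case/orP: (lt_total am) => [am'|ma].
    exists m; first by rewrite inE ms orbT.
    by move=> y; rewrite inE => /orP[/eqP ->|/mmax]; first by right.
  exists a; first exact: mem_head.
  move=> y; rewrite inE => /orP[/eqP|/mmax]; first by left.
  case=> [->|ym]; right => //; exact: lt_trans ma.
exists m; first by rewrite /gcoef mcoeff_neq0.
by move=> y py; apply: mmax; rewrite -[_ \in _]/(y \in msupp p) -mcoeff_neq0.
Qed.

Lemma grpalg_idomain : GRing.integral_domain_axiom (grpalg R G).
Proof.
move=> p q pq0; apply/norP => -[/max_supp[m pm mmax] /max_supp[l ql lmax]].
suff : gcoef (m + l) (p * q) = gcoef m p * gcoef l q.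
  by rewrite pq0 /gcoef mcoeff0 => /esym/eqP; rewrite mulf_eq0 (negbTE pm) (negbTE ql).
rewrite /gcoef [p * q]/(skmul p q) /skmul locked_withE raddf_sum /=.
have ms : m \in msupp p by rewrite -mcoeff_neq0.
have ls : l \in msupp q by rewrite -mcoeff_neq0.
have ne x y : x \in msupp p -> y \in msupp q -> (x, y) != (m, l) ->
   (x + y == m + l) = false.
  rewrite -!mcoeff_neq0 => /mmax hx /lmax hy xy; apply/negbTE/eqP => e.
  have : lt (x + y) (m + l).
    case: hx hy xy => [->|hx] [->|hy]; first by rewrite eqxx.
    - by move=> _; apply: ltDl.
    - by move=> _; rewrite addrC [m + _]addrC; apply: ltDl.
    - by move=> _; apply: ltD.
  by rewrite e lt_irr.
rewrite (big_fsetD1 m) //= [X in _ + X]big1_fset ?addr0; last first.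
  move=> x; rewrite in_fsetD1 => /andP[xm xs] _.
  rewrite raddf_sum big1_fset //= => y ys _.
  by rewrite mcoeffU [(_ * _)%g == _]ne // xpair_eqE negb_and xm.
rewrite raddf_sum (big_fsetD1 l) //= [X in _ + X]big1_fset ?addr0; last first.
  move=> y; rewrite in_fsetD1 => /andP[yl ys] _.
  by rewrite mcoeffU [(_ * _)%g == _]ne // xpair_eqE negb_and yl orbT.
by rewrite mcoeffU eqxx mulr1n.
Qed.

HB.instance Definition _ := GRing.ComUnitRing_isIntegral.Build (grpalg R G)
  grpalg_idomain.
End GroupAlgebraDomain.

Section LexicographicCone.
Context (K : realDomainType) (n : nat).

Definition lexpos (v : 'rV[K]_n) : bool :=
  [exists i : 'I_n, (0 < v ord0 i) && [forall j : 'I_n, (j < i)%N ==> (v ord0 j == 0)]].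

Lemma lexpos0 : lexpos 0 = false.
Proof. by apply/negbTE/existsPn => i; rewrite mxE ltxx. Qed.

Lemma lexposD u v : lexpos u -> lexpos v -> lexpos (u + v).
Proof.
move=> /existsP[i /andP[ui /forallP u0]] /existsP[j /andP[vj /forallP v0]].
have U (k : 'I_n) : (k < i)%N -> u ord0 k = 0 by move=> ki; apply/eqP/(implyP (u0 k)).
have W (k : 'I_n) : (k < j)%N -> v ord0 k = 0 by move=> ki; apply/eqP/(implyP (v0 k)).
have [ij|ji|ij] := ltngtP i j; apply/existsP.
- exists i; rewrite mxE (W _ ij) addr0 ui; apply/forallP => k; apply/implyP => ki.
  by rewrite mxE U // W ?addr0 // (ltn_trans ki).
- exists j; rewrite mxE (U _ ji) add0r vj; apply/forallP => k; apply/implyP => ki.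
  by rewrite mxE W // U ?addr0 // (ltn_trans ki).
- exists i; rewrite mxE addr_gt0 //; last by rewrite (_ : i = j) //; apply: val_inj.
  by apply/forallP => k; apply/implyP => ki; rewrite mxE U // W ?addr0 // -ij.
Qed.

Lemma lexpos_total v : v != 0 -> lexpos v || lexpos (- v).
Proof.
move=> v0; have [i vi] : exists i, v ord0 i != 0.
  apply/existsP; apply: contraNT v0 => /existsPn v0; apply/eqP/rowP => i.
  by rewrite mxE; apply/eqP; rewrite -[_ == _]negbK v0.
have [j vj jmin] :=
  @arg_minnP _ i (fun i => v ord0 i != 0) (fun i => val i) vi.
have V (k : 'I_n) : (k < j)%N -> v ord0 k == 0.
  by move=> kj; apply: contraTT kj => /jmin; rewrite -leqNgt.
move: vj; rewrite neq_lt => /orP[vj|vj]; apply/orP; [right|left];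
  apply/existsP; exists j; rewrite ?mxE ?oppr_gt0 vj /=;
  apply/forallP => k; apply/implyP => /V //.
by rewrite mxE oppr_eq0.
Qed.

End LexicographicCone.

Section PullbackCone.
Context (K : realDomainType) (n : nat) (G : zmodType).
Variable phi : {additive G -> 'rV[K]_n}.
Hypothesis phi_inj : injective phi.

Definition lexcone : pred G := fun x => lexpos (phi x).

Fact lexcone0 : lexcone 0 = false.
Proof. by rewrite /lexcone raddf0 lexpos0. Qed.

Fact lexconeD x y : lexcone x -> lexcone y -> lexcone (x + y).
Proof. by rewrite /lexcone raddfD; exact: lexposD. Qed.

Fact lexcone_total x : x != 0 -> lexcone x || lexcone (- x).
Proof. by move=> x0; rewrite /lexcone raddfN lexpos_total // raddf_eq0. Qed.
End PullbackCone.

Section GroupAlgebraMap.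
Context (R : comNzRingType) (G H : zmodType) (phi : {additive G -> H}).
Implicit Types p q : grpalg R G.

Definition grpalg_map p : grpalg R H :=
  \sum_(y <- msupp p) gmon (gcoef y p) (phi y).

Lemma grpalg_mapw (d : {fset G}) p : (msupp p `<=` d)%fset ->
  grpalg_map p = \sum_(y <- d) gmon (gcoef y p) (phi y).
Proof.
move=> le; rewrite /grpalg_map (big_fset_incl _ le) // => y _ /mcoeff_outdom py.
by rewrite /gcoef py /gmon /skmon monalgU0.
Qed.

Fact grpalg_map_zmod : zmod_morphism grpalg_map.
Proof.
move=> p q; pose d := (msupp p `|` msupp q)%fset.
rewrite (@grpalg_mapw d (p - q)) ?msuppB_le //.
rewrite (@grpalg_mapw d p) ?fsubsetUl // (@grpalg_mapw d q) ?fsubsetUr //.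
by rewrite -sumrB; apply/eq_bigr => y _; rewrite /gcoef mcoeffB /gmon /skmon monalgUB.
Qed.
HB.instance Definition _ :=
  GRing.isZmodMorphism.Build (grpalg R G) (grpalg R H) grpalg_map grpalg_map_zmod.

Lemma grpalg_map_gmon a y : grpalg_map (gmon a y) = gmon a (phi y).
Proof. by rewrite (grpalg_mapw msuppU_le) big_seq_fset1 /gcoef mcoeffUU. Qed.

Fact grpalg_map_monoid : monoid_morphism grpalg_map.
Proof.
split; first by rewrite grpalg_map_gmon raddf0.
move=> p q; elim/grpalg_ind: p => [a x||p1 p2 IH1 IH2]; last 2 first.
- by rewrite mul0r raddf0 mul0r.
- by rewrite mulrDl !raddfD mulrDl -IH1 -IH2.
elim/grpalg_ind: q => [b y||q1 q2 IH1 IH2]; last 2 first.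
- by rewrite mulr0 raddf0 mulr0.
- by rewrite mulrDr !raddfD mulrDr -IH1 -IH2.
by rewrite gmonM !grpalg_map_gmon gmonM raddfD.
Qed.
HB.instance Definition _ :=
  GRing.isMonoidMorphism.Build (grpalg R G) (grpalg R H) grpalg_map grpalg_map_monoid.
End GroupAlgebraMap.

Section GroupAlgebraMapTheory.
Context (R : comNzRingType) (G : zmodType).
Implicit Types p : grpalg R G.

Lemma eq_grpalg_map (f g : {additive G -> G}) p :
  f =1 g -> grpalg_map f p = grpalg_map g p.
Proof. by move=> fg; apply: eq_bigr => y _; rewrite fg. Qed.

Lemma grpalg_map_id p : grpalg_map idfun p = p.
Proof.
elim/grpalg_ind: p => [a y||p q IH1 IH2]; first by rewrite grpalg_map_gmon.
- exact: (raddf0 (grpalg_map (R := R) idfun)).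
- by rewrite (raddfD (grpalg_map (R := R) idfun)) -[in RHS]IH1 -[in RHS]IH2.
Qed.

Lemma grpalg_map_comp (f g : {additive G -> G}) p :
  grpalg_map (f \o g) p = grpalg_map f (grpalg_map g p).
Proof.
elim/grpalg_ind: p => [a y||p q IH1 IH2]; first by rewrite !grpalg_map_gmon.
- by rewrite (raddf0 (grpalg_map (R := R) g)) !(raddf0 (grpalg_map (R := R) _)).
- rewrite (raddfD (grpalg_map (R := R) g)) !(raddfD (grpalg_map (R := R) _)) /=.
  by rewrite -IH1 -IH2.
Qed.
End GroupAlgebraMapTheory.

Section FractionMap.
Context (A : idomainType) (f : {rmorphism A -> A}).
Hypothesis f_inj : injective f.
Local Notation "x %:F" := (FracField.tofrac x).
Implicit Types x y : {fraction A}.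

Definition fracmap x : {fraction A} :=
  (f \n_(repr x))%:F / (f \d_(repr x))%:F.

Lemma frac_reprE x : x = (\n_(repr x))%:F / (\d_(repr x))%:F.
Proof.
apply: (canRL (mulfK _)); first by rewrite tofrac_eq0 denom_ratioP.
rewrite -{1}[x]reprK; move: (repr x) => r; unlock FracField.tofrac.
rewrite -[LHS]FracField.pi_mul; apply/eqmodP; rewrite /= FracField.equivfE /FracField.mulf.
by rewrite !numden_Ratio ?mulf_neq0 ?oner_neq0 ?denom_ratioP // !mulr1 mulrC.
Qed.

Lemma fracmapE n d : d != 0 -> fracmap (n%:F / d%:F) = (f n)%:F / (f d)%:F.
Proof.
move=> d0; rewrite /fracmap; set x := n%:F / d%:F.
have f0 a : a != 0 -> (f a)%:F != 0 by move=> a0; rewrite tofrac_eq0 raddf_eq0.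
have r0 : \d_(repr x) != 0 by exact: denom_ratioP.
have e : \n_(repr x) * d = n * \d_(repr x).
  apply/eqP; rewrite -tofrac_eq !tofracM; apply/eqP.
  have := frac_reprE x; rewrite {1}/x => /eqP.
  rewrite eqr_div ?tofrac_eq0 // => /eqP <-; by rewrite mulrC.
by apply/eqP; rewrite eqr_div ?f0 // -!tofracM -!rmorphM e.
Qed.

Lemma fracmap_tofrac a : fracmap a%:F = (f a)%:F.
Proof. by rewrite -[a%:F]divr1 -tofrac1 fracmapE ?oner_neq0 // rmorph1 tofrac1 divr1. Qed.

Lemma fracmap_zmod : zmod_morphism fracmap.
Proof.
move=> x y; rewrite [x]frac_reprE [y]frac_reprE.
move: (denom_ratioP (repr x)) (denom_ratioP (repr y)).
set a := \n_(repr x); set b := \d_(repr x).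
set c := \n_(repr y); set d := \d_(repr y) => b0 d0.
have F0 (z : A) : z != 0 -> z%:F != 0 by rewrite tofrac_eq0.
have f0 (z : A) : z != 0 -> (f z)%:F != 0 by move=> z0; rewrite F0 // raddf_eq0.
rewrite -mulNr addf_div ?F0 // -tofracN -!tofracM -tofracD.
rewrite !fracmapE ?mulf_neq0 // -mulNr addf_div ?f0 //.
by rewrite -tofracN -!tofracM -tofracD rmorphD !rmorphM rmorphN.
Qed.

Lemma fracmap_monoid : monoid_morphism fracmap.
Proof.
split; first by rewrite -tofrac1 fracmap_tofrac rmorph1.
move=> x y; rewrite [x]frac_reprE [y]frac_reprE.
move: (denom_ratioP (repr x)) (denom_ratioP (repr y)).
set a := \n_(repr x); set b := \d_(repr x).
set c := \n_(repr y); set d := \d_(repr y) => b0 d0.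
by rewrite mulf_div -!tofracM !fracmapE ?mulf_neq0 // mulf_div -!tofracM !rmorphM.
Qed.

Definition fracmap_rmorphism : {rmorphism {fraction A} -> {fraction A}} :=
  HB.pack fracmap
    (GRing.isZmodMorphism.Build _ _ fracmap fracmap_zmod)
    (GRing.isMonoidMorphism.Build _ _ fracmap fracmap_monoid).
End FractionMap.

Section FractionMapTheory.
Context (A : idomainType).
Implicit Types (f g h : {rmorphism A -> A}) (x : {fraction A}).

Lemma fracmap_id f x : f =1 id -> fracmap f x = x.
Proof. by move=> fid; rewrite [RHS]frac_reprE /fracmap !fid. Qed.

Lemma fracmap_comp f g h x : injective f -> injective g ->
  h =1 f \o g -> fracmap h x = fracmap f (fracmap g x).
Proof.
move=> fI gI hfg; rewrite [fracmap g x]/fracmap fracmapE //.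
  by rewrite /fracmap !hfg.
by rewrite raddf_eq0 // denom_ratioP.
Qed.
End FractionMapTheory.

Definition is_gcm (R : realType) (I : finType) (a : I -> I -> R) : Prop :=
  [/\ forall i j, a i j \is a Num.int,
      forall i, a i i = 2,
      forall i j, i != j -> a i j <= 0
    & forall i j, a i j = 0 -> a j i = 0].

Record root_datum (R : realType) (V : vectType R) (I : finType) := RootDatum {
  alpha : I -> 'Hom(V, R^o);
  alphav : I -> V;
  alpha_free : free [seq alpha i | i <- enum I];
  alphav_free : free [seq alphav i | i <- enum I];
  alpha_gcm : is_gcm (fun i j => alpha j (alphav i))
}.

Definition vcoord (R : realType) (V : vectType R) (v : V) :
  'rV[R]_(\dim {:V}) := \row_i coord (vbasis {:V}) i v.

Section Weyl.
Context (R : realType) (V : vectType R) (I : finType) (D : root_datum V I).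
Implicit Types (i : I) (v : V) (s : seq I).

Definition refl_fun i v : V := v - alpha D i v *: alphav D i.

Fact refl_fun_linear i : linear (refl_fun i).
Proof.
move=> a u v; rewrite /refl_fun linearP scalerDl opprD addrACA scalerBr scalerA.
by [].
Qed.
HB.instance Definition _ i := GRing.isLinear.Build R V V *:%R (refl_fun i)
  (refl_fun_linear i).

Definition refl i : 'End(V) := linfun (refl_fun i).

Lemma reflE i v : refl i v = v - alpha D i v *: alphav D i.
Proof. by rewrite lfunE. Qed.

Lemma reflK i : (refl i \o refl i)%VF = \1%VF.
Proof.
have [_ a2 _ _] := alpha_gcm D.
apply/lfunP => v; rewrite comp_lfunE id_lfunE !reflE.
have -> : alpha D i (v - alpha D i v *: alphav D i) = - alpha D i v.
  by rewrite linearB linearZ /= a2 /GRing.scale /= mulr_natr mulr2n opprD addNKr.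
by rewrite scaleNr opprK subrK.
Qed.

Definition word s : 'End(V) := foldr (fun i g => refl i \o g)%VF \1%VF s.

Lemma word_cat s t : word (s ++ t) = (word s \o word t)%VF.
Proof. by elim: s => [|i s IH] /=; rewrite ?comp_lfun1l // IH comp_lfunA. Qed.

Lemma word_rev s : (word (rev s) \o word s)%VF = \1%VF.
Proof.
elim: s => [|i s IH]; first by rewrite comp_lfun1l.
rewrite rev_cons -cats1 word_cat /= comp_lfun1r -comp_lfunA.
by rewrite (comp_lfunA (refl i)) reflK comp_lfun1l.
Qed.

Lemma word_revr s : (word s \o word (rev s))%VF = \1%VF.
Proof. by rewrite -{1}[s]revK word_rev. Qed.

(* As the reflections are involutions, the group they generate consists of *)
(* the products of reflections. *)
Record weyl := Weyl {
  weyl_val :> 'End(V);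
  _ : `[< exists s, weyl_val = word s >]
}.
HB.instance Definition _ := [isSub for weyl_val].
HB.instance Definition _ := [Choice of weyl by <:].

Lemma weyl_word (w : weyl) : exists s, w = word s :> 'End(V).
Proof. exact/asboolP/(valP w). Qed.

Fact wone_subproof : `[< exists s, \1%VF = word s >].
Proof. by apply/asboolP; exists [::]. Qed.
Definition wone := Weyl wone_subproof.

Fact wmul_subproof (g h : weyl) : `[< exists s, (g \o h)%VF = word s >].
Proof.
apply/asboolP; have [s ->] := weyl_word g; have [t ->] := weyl_word h.
by exists (s ++ t); rewrite word_cat.
Qed.
Definition wmul g h := Weyl (wmul_subproof g h).

Lemma weyl_lker (g : weyl) : lker g == 0%VS.
Proof.
have [s ->] := weyl_word g; apply/lker0P => u v e.
by rewrite -[u]id_lfunE -[v]id_lfunE -(word_rev s) !comp_lfunE e.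
Qed.

Fact winv_subproof (g : weyl) : `[< exists s, (g^-1)%VF = word s >].
Proof.
apply/asboolP; have [s gs] := weyl_word g; exists (rev s).
rewrite -[LHS]comp_lfun1l -(word_rev s) -gs -comp_lfunA.
by rewrite lker0_compfV ?weyl_lker // comp_lfun1r.
Qed.
Definition winv g := Weyl (winv_subproof g).

Fact wmulA : associative wmul.
Proof. by move=> f g h; apply: val_inj; rewrite /= comp_lfunA. Qed.
Fact wmul1g : left_id wone wmul.
Proof. by move=> g; apply: val_inj; rewrite /= comp_lfun1l. Qed.
Fact wmulg1 : right_id wone wmul.
Proof. by move=> g; apply: val_inj; rewrite /= comp_lfun1r. Qed.
Fact wmulVg : left_inverse wone winv wmul.
Proof. by move=> g; apply: val_inj; rewrite /= lker0_compVf ?weyl_lker. Qed.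
Fact wmulgV : right_inverse wone winv wmul.
Proof. by move=> g; apply: val_inj; rewrite /= lker0_compfV ?weyl_lker. Qed.

HB.instance Definition _ := isGroup.Build weyl wmulA wmul1g wmulg1 wmulVg wmulgV.

Fact sref_subproof i : `[< exists s, refl i = word s >].
Proof. by apply/asboolP; exists [:: i]; rewrite /= comp_lfun1r. Qed.
Definition sref i : weyl := Weyl (sref_subproof i).

Definition has_word_of_size (w : weyl) : pred nat :=
  fun n => `[< exists s : seq I, size s = n /\ w = word s :> 'End(V) >].

Fact has_word (w : weyl) : exists n, has_word_of_size w n.
Proof. by have [s ws] := weyl_word w; exists (size s); apply/asboolP; exists s. Qed.

Definition ell (w : weyl) : nat := ex_minn (has_word w).

(* w acts on V^* by (w a)(v) = a (w^-1 v). *)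
Definition real_root (a : 'Hom(V, R^o)) : Prop :=
  exists (w : weyl) (i : I), a = (alpha D i \o (w^-1)%g)%VF.

Record coweight_lattice := CoweightLattice {
  lat : {pred V};
  lat_zmod : zmod_closed lat;
  lat_discrete : forall y, y \in lat ->
    \forall r \near vcoord y, forall v, v \in lat -> vcoord v = r -> v = y;
  lat_coroot : forall n : I -> int, \sum_i alphav D i *~ n i \in lat;
  lat_root : forall a v, real_root a -> v \in lat -> a v \is a Num.int
}.

End Weyl.

Section Lattice.
Context (R : realType) (V : vectType R) (I : finType) (D : root_datum V I).
Context (L : coweight_lattice D).
Local Notation W := (weyl D).

HB.instance Definition _ := GRing.isZmodClosed.Build V (lat L) (lat_zmod L).

Record latY := LatY { latY_val :> V; _ : latY_val \in lat L }.
HB.instance Definition _ := [isSub for latY_val].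
HB.instance Definition _ := [Choice of latY by <:].
HB.instance Definition _ := [SubChoice_isSubZmodule of latY by <:].

Lemma alphav_lat i : alphav D i \in lat L.
Proof.
have := lat_coroot L (fun j => (j == i)%:R); rewrite (bigD1 i) //= eqxx.
by rewrite big1 ?addr0 // => j /negbTE ->; rewrite mulr0z.
Qed.
Definition coroot i : latY := LatY (alphav_lat i).

Lemma alpha_real_root i : real_root D (alpha D i).
Proof.
exists 1%g, i; apply/lfunP => v; rewrite comp_lfunE /=; congr (alpha D i _).
have /lfunP/(_ v) := congr1 val (invg1 W); rewrite /= id_lfunE => -> //.
Qed.

Lemma weyl_lat (w : W) v : v \in lat L -> w v \in lat L.
Proof.
have [s ->] := weyl_word w; elim: s v => [|i s IH] v vL /=; first by rewrite id_lfunE.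
rewrite comp_lfunE reflE rpredB ?IH //.
have /intrP[m ->] := lat_root (alpha_real_root i) (IH _ vL).
by rewrite scaler_int rpredMz ?alphav_lat.
Qed.

Definition actY (w : W) (y : latY) : latY := LatY (weyl_lat w (valP y)).
End Lattice.

Section ExponentCone.
Context (T : finType).

Definition expo_row (f : {ffun T -> int}) : 'rV[int]_#|T| := \row_k f (enum_val k).

Fact expo_row_zmod : zmod_morphism expo_row.
Proof. by move=> f g; apply/rowP => k; rewrite !mxE !ffunE. Qed.
HB.instance Definition _ := GRing.isZmodMorphism.Build _ _ expo_row expo_row_zmod.

Fact expo_row_inj : injective expo_row.
Proof.
move=> f g /rowP fg; apply/ffunP => k.
by have := fg (enum_rank k); rewrite !mxE enum_rankK.
Qed.

HB.instance Definition _ := Zmodule_hasPosCone.Build {ffun T -> int}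
  (lexcone0 expo_row) (lexconeD (phi := expo_row)) (lexcone_total expo_row_inj).
End ExponentCone.

Section LatticeCone.
Context (R : realType) (V : vectType R) (I : finType) (D : root_datum V I).
Context (L : coweight_lattice D).

Definition latY_row (y : latY L) : 'rV[R]_(\dim {:V}) := vcoord (val y).

Fact latY_row_zmod : zmod_morphism latY_row.
Proof. by move=> x y; apply/rowP => k; rewrite !mxE /= linearB. Qed.
HB.instance Definition _ := GRing.isZmodMorphism.Build _ _ latY_row latY_row_zmod.

Fact latY_row_inj : injective latY_row.
Proof.
move=> x y /rowP xy; apply: val_inj; rewrite /=.
rewrite [LHS](coord_vbasis (memvf _)) [RHS](coord_vbasis (memvf _)).
by apply: eq_bigr => k _; have := xy k; rewrite !mxE => ->.
Qed.

HB.instance Definition _ := Zmodule_hasPosCone.Build (latY L)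
  (lexcone0 latY_row) (lexconeD (phi := latY_row)) (lexcone_total latY_row_inj).
End LatticeCone.

Section Indeterminates.
Context (R : realType) (V : vectType R) (I : finType) (D : root_datum V I).
Context (L : coweight_lattice D).

(* inl i stands for sigma_i and inr i for sigma'_i. *)
Definition indet_index (x : I + I) : I := match x with inl i | inr i => i end.

Definition indet_rel : rel (I + I) := fun x y =>
  let i := indet_index x in let j := indet_index y in
  ((i == j) && `[< (alpha D i @` [set` lat L] = [set` Num.int])%classic >])
  || ((alpha D i (alphav D j) == -1) && (alpha D j (alphav D i) == -1)).


Lemma indet_rel_sym : symmetric indet_rel.
Proof.
move=> x y; rewrite /indet_rel [X in _ || X]andbC; congr (_ || _).
by rewrite [in RHS]eq_sym; case: eqP => //= ->.
Qed.

(* The classes of the equivalence relation generated by the identifications, *)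
(* each one given by its canonical representative. *)
Record indet := Indet { indet_val :> I + I; _ : indet_val \in roots indet_rel }.
HB.instance Definition _ := [isSub for indet_val].
HB.instance Definition _ := [Finite of indet by <:].

Definition indet_class (x : I + I) : indet :=
  Indet (roots_root (sym_connect_sym indet_rel_sym) x).

(* Laurent polynomials: the group algebra of the group of exponents. *)
Definition Zsig : idomainType := grpalg int {ffun indet -> int}.

Definition indet_var (x : I + I) : Zsig :=
  gmon 1 [ffun k => (k == indet_class x)%:R].
Definition sigma (i : I) : Zsig := indet_var (inl i).
Definition sigma' (i : I) : Zsig := indet_var (inr i).

Definition ZY : idomainType := grpalg Zsig (latY L).
Definition FY : fieldType := {fraction ZY}.
End Indeterminates.

Section Target.
Context (R : realType) (V : vectType R) (I : finType) (D : root_datum V I).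
Context (L : coweight_lattice D).
Local Notation W := (weyl D).
Local Notation Y := (latY L).
Local Notation Zs := (Zsig L).
Local Notation "x %:F" := (FracField.tofrac x).

Lemma actY1 y : actY 1%g y = y :> Y.
Proof. by apply: val_inj; rewrite /= id_lfunE. Qed.

Lemma actYM (g h : W) y : actY (g * h)%g y = actY g (actY h y) :> Y.
Proof. by apply: val_inj; rewrite /= comp_lfunE. Qed.

Fact actY_zmod (g : W) : zmod_morphism (@actY _ _ _ _ L g).
Proof. by move=> x y; apply: val_inj; rewrite /= linearB. Qed.
HB.instance Definition _ g :=
  GRing.isZmodMorphism.Build Y Y (@actY _ _ _ _ L g) (actY_zmod g).

Definition actZY (w : W) : {rmorphism ZY L -> ZY L} :=
  @grpalg_map Zs Y Y (@actY _ _ _ _ L w).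

Lemma actZY_gmon w a (y : Y) : actZY w (gmon a y) = gmon a (actY w y).
Proof. exact: grpalg_map_gmon. Qed.

Lemma actZY1 p : actZY 1%g p = p.
Proof. by rewrite -[RHS]grpalg_map_id; apply: eq_grpalg_map => y; exact: actY1. Qed.

Lemma actZYM g h p : actZY (g * h)%g p = actZY g (actZY h p).
Proof.
by rewrite /actZY /= -grpalg_map_comp; apply: eq_grpalg_map => y; exact: actYM.
Qed.

Lemma actZY_inj w : injective (actZY w).
Proof.
by apply: (can_inj (g := actZY w^-1%g)) => p; rewrite -actZYM mulVg actZY1.
Qed.

Definition actFY (w : W) : {rmorphism FY L -> FY L} :=
  fracmap_rmorphism (@actZY_inj w).

Fact actFY1 f : actFY 1%g f = f.
Proof. by apply: fracmap_id => p; exact: actZY1. Qed.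

Fact actFYM g h f : actFY (g * h)%g f = actFY g (actFY h f).
Proof. by apply: fracmap_comp; [exact: actZY_inj..|move=> p; exact: actZYM]. Qed.

Lemma actFY_tofrac w p : actFY w p%:F = (actZY w p)%:F.
Proof. by apply: fracmap_tofrac; exact: actZY_inj. Qed.

Definition FY_const : {rmorphism Zs -> FY L} :=
  (@FracField.tofrac (ZY L) \o @gconst Zs Y).

Fact actFY_const w a : actFY w (FY_const a) = FY_const a.
Proof.
apply: etrans (actFY_tofrac w _) _; congr (_%:F).
by apply: etrans (actZY_gmon w a 0) _; rewrite raddf0.
Qed.

Definition FY_action : ring_action Zs W (FY L) :=
  RingAction actFY1 actFYM actFY_const.

(* Frac(Z_sigma[Y])[W], of which Z_sigma(Y)[W] is the subalgebra of the *)
(* elements with coefficients in Z_sigma(Y). *)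
Definition FYW : algType Zs := skew_algebra FY_action.

Definition FYW_mon (f : FY L) (w : W) : FYW := skmon FY_action f w.

Definition in_Qpos (q : Y) : Prop :=
  exists n : I -> nat, q = \sum_i coroot L i *+ n i.

(* The series sum_y F(y) e^y has its support in a finite union of sets *)
(* mu - w Q^vee_+. *)
Definition cone_supported (w : W) (F : Y -> Zs) : Prop :=
  exists s : seq Y, forall y, F y != 0 ->
    exists mu q, [/\ mu \in s, in_Qpos q & y = mu - actY w q].

Definition mul_series (q : ZY L) (F : Y -> Zs) (y : Y) : Zs :=
  \sum_(x <- msupp q) gcoef x q * F (y - x).

(* F is an expansion of p / q when q F = p. As no nonzero element of *)
(* Z_sigma[Y] annihilates a nonzero cone-supported series, this depends only *)
(* on the fraction, and determines F. *)
Definition has_expansion (w : W) (f : FY L) : Prop :=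
  exists (p q : ZY L) (F : Y -> Zs),
    [/\ q != 0, f = p%:F / q%:F, cone_supported w F &
        forall y, mul_series q F y = gcoef y p].

(* Z_sigma(Y) *)
Definition ZsY : {pred FY L} := fun f => `[< forall w, has_expansion w f >].

(* Z_sigma(Y)[W] *)
Definition ZsYW : {pred FYW} := fun x => `[< forall w : W, mcoeff w x \in ZsY >].

Definition expY (y : Y) : FY L := (gmon 1 y : ZY L)%:F.

Definition b_fun (K : fieldType) (t u z : K) : K :=
  ((t - t^-1) + (u - u^-1) * z) / (1 - z ^+ 2).

Definition c_fun (K : fieldType) (t u z : K) : K := t - b_fun t u z.

Definition b_at (i : I) (z : FY L) : FY L :=
  b_fun (FY_const (sigma L i)) (FY_const (sigma' L i)) z.

Definition b_coroot (i : I) : FY L := b_at i (expY (coroot L i)).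

Definition c_coroot (i : I) : FY L :=
  c_fun (FY_const (sigma L i)) (FY_const (sigma' L i)) (expY (coroot L i)).

(* H is the Bernstein-Lusztig-Hecke algebra with basis Z^lambda H_w = ZH lambda w. *)
(* In the last relation, p is the element of Z_sigma[Y] equal to *)
(* b(sigma_i, sigma'_i; e^(- alpha_i^vee)) (e^lambda - e^(r_i lambda)), and *)
(* the right-hand side is its image under e^mu |-> Z^mu. *)
Record BL_hecke (H : algType Zs) (ZH : Y -> W -> H) : Prop := BLHecke {
  BL_basis : forall h : H, exists! a : {malg Zs[(Y * W)%type]},
    h = \sum_(k <- msupp a) mcoeff k a *: ZH k.1 k.2;
  BL_unity : ZH 0 1%g = 1;
  BL_mulZH : forall l w, ZH l 1%g * ZH 0 w = ZH l w;
  BL_mulHH_up : forall i w, (ell w < ell (sref D i * w)%g)%N ->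
    ZH 0 (sref D i) * ZH 0 w = ZH 0 (sref D i * w)%g;
  BL_mulHH_down : forall i w, (ell (sref D i * w)%g < ell w)%N ->
    ZH 0 (sref D i) * ZH 0 w =
    (sigma L i - (sigma L i)^-1) *: ZH 0 w + ZH 0 (sref D i * w)%g;
  BL_mulZZ : forall l m, ZH l 1%g * ZH m 1%g = ZH (l + m) 1%g;
  BL_mulHZ : forall i l, exists2 p : ZY L,
    p%:F = b_at i (expY (- coroot L i)) * (expY l - expY (actY (sref D i) l)) &
    ZH 0 (sref D i) * ZH l 1%g - ZH (actY (sref D i) l) 1%g * ZH 0 (sref D i) =
    \sum_(m <- msupp p) gcoef m p *: ZH m 1%g
}.

End Target.

Arguments ZsY {R V I D} L _.
Arguments ZsYW {R V I D} L _.

(* Main.v *)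
Require Import Defs.
From HB Require Import structures.
From mathcomp Require Import all_boot all_order all_algebra.
From mathcomp Require Import finmap monalg.
From mathcomp Require Import boolp reals.
From mathcomp Require Import ring zify.

Set Implicit Arguments.
Unset Strict Implicit.
Unset Printing Implicit Defensive.

Import Order.TTheory GRing.Theory Num.Theory.
Local Open Scope ring_scope.

(** The operators Psi(H_i) = c(alpha_i^vee)[r_i] + b(alpha_i^vee) are the
Demazure-Lusztig operators, and they satisfy the relations of the Hecke algebra
because they already act in a module over it. This avoids any direct check of
the braid relations.

The module is the principal representation: the Hecke algebra H has the basis
Z^lambda H_w, the subalgebra spanned by the H_w has the trivial character
H_w |-> chi(w), where chi(w) is the product of the sigma_i along a reduced word
of w, and the module induced from chi is the space of the e^(- lambda). The map
H -> Frac(Z_sigma[Y]), Z^lambda H_w |-> chi(w) e^(- lambda) ([vac]) is the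
projection onto that module. By the Bernstein-Lusztig relation, left
multiplication by H_i becomes the operator Psi(H_i), and left multiplication by
Z^lambda becomes e^(- lambda) ([acts_as_H], [acts_as_Z]). If Psi is defined on
the basis by Psi(Z^lambda H_w) = e^(- lambda) Psi(H_i1) ... Psi(H_in), with
i1 ... in a reduced word of w, then h acts as Psi(h) for every h
([acts_as_Psi]). An element of the skew group algebra is determined by its
operator, as distinct elements of W give independent characters of Y
([skapply_faithful]); hence Psi is multiplicative.

The character chi exists since the product of the sigma_i is the same along all
reduced words of w ([sgprod_reduced]). By the exchange condition this reduces
to the case r_j u = u r_i with both sides reduced, and there H_j H_u = H_u H_i;
comparing the quadratic relations of H_i and H_j in the Hecke algebra itself
gives sigma_i - 1/sigma_i = sigma_j - 1/sigma_j, hence sigma_i = sigma_j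
([sg_conj]).

The facts on W all follow from one positivity statement: if r_i does not
shorten w on the right, then w alpha_i^vee is a combination of simple coroots
with coefficients in the natural numbers ([posc_ell]). It is proved by
induction on the length, by splitting off from w a maximal alternating product
in two simple reflections and computing in rank two ([dihedral]). It gives the
sign-coherence of real coroots, the faithfulness of W on the coroots
([weyl_coroot_inj]) and the exchange condition ([exchange]).

Injectivity is triangularity: Psi(Z^lambda H_w) has the coefficient
e^(- lambda) times a nonzero product of conjugates of the c(alpha_i^vee) at
[w], and its other coefficients are at elements shorter than w ([coeff_PsiW]).

Finally, all the coefficients of Psi(h) are fractions whose denominators are
products of 1 - e^y with y twice a real coroot. For each w, such a y lies in
w Q^vee_+ or in - w Q^vee_+, so that 1 / (1 - e^y) expands as a geometric
series in the required direction ([geometric_series], [geomfrac_ZsY]). *)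

(** * Words, length and coordinates on the coroots *)

Section WeylGroup.
Context (R : realType) (V : vectType R) (I : finType) (D : root_datum V I).
Local Notation W := (weyl D).
Local Notation r := (sref D).
Local Notation av := (alphav D).
Implicit Types (w g h : W) (i j : I) (s t : seq I) (v : V).

Lemma weylME g h v : (g * h)%g v = g (h v).
Proof. exact: comp_lfunE. Qed.

Lemma weyl1E v : (1%g : W) v = v.
Proof. exact: id_lfunE. Qed.

Lemma weylP g h : (forall v, g v = h v) -> g = h.
Proof. by move=> gh; apply/val_inj/lfunP. Qed.

Lemma srefE i v : r i v = v - alpha D i v *: av i.
Proof. exact: reflE. Qed.

Lemma srefK i : (r i * r i = 1)%g.
Proof. by apply/val_inj/reflK. Qed.

Lemma srefV i : ((r i)^-1 = r i)%g.
Proof. by rewrite -[LHS]mulg1 -(srefK i) mulKg. Qed.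

Lemma alpha_av i : alpha D i (av i) = 2 :> R.
Proof. by have [_ ->] := alpha_gcm D. Qed.

Lemma sref_av i : r i (av i) = - av i.
Proof. by rewrite srefE alpha_av scaler_nat mulr2n opprD addNKr. Qed.

Definition wprod s : W := foldr (fun i g => r i * g)%g 1%g s.

Lemma wprodE s : wprod s = word D s :> 'End(V).
Proof. by elim: s => //= i s ->. Qed.

Lemma wprod_cat s t : wprod (s ++ t) = (wprod s * wprod t)%g.
Proof. by elim: s => [|i s IH] /=; rewrite ?mul1g // IH mulgA. Qed.

Lemma wprod_rcons s i : wprod (rcons s i) = (wprod s * r i)%g.
Proof. by rewrite -cats1 wprod_cat; congr (_ * _)%g; exact: mulg1. Qed.

Lemma wprod_rev s : wprod (rev s) = (wprod s)^-1%g.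
Proof.
elim: s => [|i s IH]; first by rewrite invg1.
by rewrite rev_cons wprod_rcons IH /= invgM srefV.
Qed.

Lemma ell_le s : (ell (wprod s) <= size s)%N.
Proof.
rewrite /ell; case: ex_minnP => n _; apply; apply/asboolP; exists s.
by rewrite wprodE.
Qed.

Lemma ell_word w : exists2 s, size s = ell w & w = wprod s.
Proof.
rewrite /ell; case: ex_minnP => n /asboolP[s [sn ws]] _; exists s => //.
by apply: val_inj; rewrite /= wprodE.
Qed.

Lemma ellV w : ell w^-1%g = ell w.
Proof.
suff le (x : W) : (ell x^-1%g <= ell x)%N by apply/eqP; rewrite eqn_leq le -{1}[w]invgK le.
by have [s <- ->] := ell_word x; rewrite -wprod_rev -size_rev ell_le.
Qed.

Lemma ellM g h : (ell (g * h)%g <= ell g + ell h)%N.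
Proof.
have [s <- ->] := ell_word g; have [t <- ->] := ell_word h.
by rewrite -wprod_cat -size_cat ell_le.
Qed.

Lemma ell1 : ell (1%g : W) = 0%N.
Proof. by apply/eqP; rewrite -leqn0; exact: (ell_le [::]). Qed.

Lemma ell_sref i : (ell (r i) <= 1)%N.
Proof. by have := ell_le [:: i]; rewrite /= mulg1. Qed.

Lemma ell_le_mulr w i : (ell w <= (ell (w * r i)%g).+1)%N.
Proof.
rewrite -{1}[w]mulg1 -(srefK i) mulgA -addn1.
by apply: leq_trans (ellM _ _) _; rewrite leq_add2l ell_sref.
Qed.

Lemma ell_le_mull w i : (ell w <= (ell (r i * w)%g).+1)%N.
Proof. by rewrite -ellV -(ellV (r i * w)%g) invgM srefV ell_le_mulr. Qed.

Definition reduced s := ell (wprod s) = size s.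

Lemma reduced_catP s t : reduced (s ++ t) -> reduced s /\ reduced t.
Proof.
rewrite /reduced wprod_cat size_cat => e.
have := ellM (wprod s) (wprod t); rewrite e.
by have := ell_le s; have := ell_le t; split; lia.
Qed.

Lemma ell_descent w : w <> 1%g -> exists i, (ell (w * r i)%g < ell w)%N.
Proof.
move=> w1; have [s sw ws] := ell_word w.
case/lastP: s sw ws => [|s i] sw ws; first by case: w1.
exists i; rewrite -sw ws wprod_rcons -mulgA srefK mulg1.
by rewrite size_rcons ltnS ell_le.
Qed.

Definition av_seq := [seq av i | i <- enum I].

Fact av_idx_proof i : (index i (enum I) < size av_seq)%N.
Proof. by rewrite size_map index_mem mem_enum. Qed.

(** The functional that is dual to [av i] on the span of the coroots, which
exists as the coroots are free. *)
Definition av_coef i : V -> R := coord (in_tuple av_seq) (Ordinal (av_idx_proof i)).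

HB.instance Definition _ i := GRing.Linear.on (av_coef i).

Lemma av_coefE i j : av_coef i (av j) = (j == i)%:R.
Proof.
have Xj : av j = (in_tuple av_seq)`_(index j (enum I)).
  by rewrite /= (nth_map j) ?nth_index ?mem_enum ?index_mem ?mem_enum.
rewrite /av_coef Xj (coord_free (Ordinal (av_idx_proof j)) (Ordinal (av_idx_proof i))).
  rewrite -val_eqE /=; congr (_%:R); congr nat_of_bool.
  apply/eqP/eqP => [|-> //] => /(congr1 (nth i (enum I))).
  by rewrite !nth_index ?mem_enum.
exact: alphav_free.
Qed.

Lemma av_coef_sum i (n : I -> nat) : av_coef i (\sum_j av j *+ n j) = (n i)%:R.
Proof.
rewrite linear_sum (bigD1 i) //= linearMn /= av_coefE eqxx big1 ?addr0 //.
by move=> j /negbTE ji; rewrite linearMn /= av_coefE ji mul0rn.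
Qed.

Lemma av_neq0 i : av i != 0.
Proof.
apply/eqP => /(congr1 (av_coef i)) /eqP.
by rewrite av_coefE eqxx linear0 oner_eq0.
Qed.

(** The cone Q^vee_+, as a subset of V. *)
Definition posc v := exists n : I -> nat, v = \sum_i av i *+ n i.

Lemma posc_av i : posc (av i).
Proof.
exists (fun j => (j == i) : nat); rewrite (bigD1 i) //= eqxx big1 ?addr0 //.
by move=> j /negbTE ->.
Qed.

Lemma poscD u v : posc u -> posc v -> posc (u + v).
Proof.
move=> [m ->] [n ->]; exists (fun i => m i + n i)%N.
by rewrite -big_split /=; apply: eq_bigr => i _; rewrite mulrnDr.
Qed.

Lemma posc0 : posc 0.
Proof. by exists (fun=> 0%N); rewrite big1. Qed.

Lemma poscMn v n : posc v -> posc (v *+ n).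
Proof. by move=> pv; elim: n => [|n IH]; [exact: posc0|rewrite mulrS; apply: poscD]. Qed.

Lemma posc_coef i v : posc v -> 0 <= av_coef i v.
Proof. by case=> n ->; rewrite av_coef_sum ler0n. Qed.

Lemma posc_neg v : posc v -> posc (- v) -> v = 0.
Proof.
case=> n vn pN; rewrite vn big1 // => i _.
have := posc_coef i pN; rewrite linearN /= vn av_coef_sum oppr_ge0 lern0.
by move=> /eqP ->.
Qed.

End WeylGroup.

(** * Rank two *)

Section RankTwo.
Context (R : realType) (V : vectType R) (I : finType) (D : root_datum V I).
Local Notation W := (weyl D).
Local Notation r := (sref D).
Local Notation av := (alphav D).
Implicit Types (w g h : W) (i j : I) (s t : seq I) (v : V).

(** The product of [k] simple reflections that alternate between [i] and [j],
and whose rightmost factor, the first one to be applied, is [r j]. *)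
Fixpoint alt i j k : W := if k is k'.+1 then (alt j i k' * r j)%g else 1%g.

Lemma altS i j k : alt i j k.+1 = (alt j i k * r j)%g.
Proof. by []. Qed.

Lemma alt_left i j k :
  alt i j k.+1 = (r (if odd k then i else j) * alt i j k)%g.
Proof.
elim: k i j => [|k IH] i j; first by rewrite altS mul1g mulg1.
by rewrite altS IH -mulgA -altS /=; case: odd.
Qed.

Lemma ell_alt i j k : (ell (alt i j k) <= k)%N.
Proof.
elim: k i j => [|k IH] i j; first by rewrite ell1.
apply: leq_trans (ellM _ _) _; rewrite -addn1; apply: leq_add => //.
exact: ell_sref.
Qed.

(** Used to recognize, inside a long alternating product, the part of length
[m] to which a braid relation applies. *)
Lemma alt_split i j m n :
  exists2 g, (ell g <= n)%N & alt i j (m + n) = (g * alt i j m)%g.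
Proof.
elim: m i j => [|m IH] i j; first by exists (alt i j n); rewrite ?ell_alt ?mulg1.
by have [g gn e] := IH j i; exists g => //; rewrite addSn !altS e mulgA.
Qed.

Lemma cartan_nat i j : i != j -> exists a : nat, alpha D i (av j) = - a%:R.
Proof.
move=> ij; have [int_a _ neg_a _] := alpha_gcm D.
have /intrP[z za] := int_a j i; have := neg_a j i; rewrite eq_sym => /(_ ij).
rewrite za lerz0 => z0; exists `|z|%N.
by rewrite pmulrn -abszN gez0_abs ?oppr_ge0 // rmorphN opprK.
Qed.

(** Here [x] and [y] are the coefficients of [av i] and [av j] in a vector, and
[A] and [B] are the opposites of [alpha i (av j)] and [alpha j (av i)]. The
test says that no coefficient becomes negative while the [k] reflections of
[alt i j k] are applied. The roles of [i] and [j] are exchanged at each step.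
*)
Fixpoint alt_pos (A B k x y : nat) : bool :=
  if k is k'.+1 then (y <= B * x)%N && alt_pos B A k' (B * x - y) x else true.

Lemma alt_posP i j A B k x y :
  alpha D i (av j) = - A%:R -> alpha D j (av i) = - B%:R -> alt_pos A B k x y ->
  exists m n : nat, alt i j k (av i *+ x + av j *+ y) = av i *+ m + av j *+ n.
Proof.
move=> hA hB; elim: k i j A B x y hA hB => [|k IH] i j A B x y hA hB.
  by move=> _; exists x, y; exact: weyl1E.
case/andP=> yB /(IH _ _ _ _ _ _ hB hA) [m [n e]]; exists n, m.
rewrite [RHS]addrC -e altS weylME; congr (alt j i k _).
rewrite srefE; have -> : alpha D j (av i *+ x + av j *+ y) = 2 * y%:R - B%:R * x%:R.
  by rewrite linearD !linearMn /= hB alpha_av !mulr_natr mulNrn addrC.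
rewrite -!(scaler_nat _ (av i)) -!(scaler_nat _ (av j)) natrB // natrM.
rewrite [RHS]addrC -addrA -scalerBl.
by congr (_ + _ *: _); ring.
Qed.

(** When [A * B >= 4] the alternating products have infinite order, and the
inequality [2 * y <= B * x] reproduces itself: after one step it reads [2 * x
<= A * (B * x - y)], a consequence of [4 * x <= A * B * x]. *)
Lemma alt_pos_inf A B k x y : (4 <= A * B)%N -> (2 * y <= B * x)%N ->
  alt_pos A B k x y.
Proof.
elim: k A B x y => //= k IH A B x y AB yB.
have yB' : (y <= B * x)%N by lia.
rewrite yB' IH //=; first by rewrite mulnC.
by have := leq_mul AB (leqnn x); nia.
Qed.

(** An alternating product moves [v] by a combination of [av i] and [av j];
this is the pair of its coefficients, for [X] and [Y] the values of [alpha i]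
and [alpha j] at [v]. It turns braid relations into polynomial identities. *)
Fixpoint alt_aff (A B X Y : R) k (x y : R) : R * R :=
  if k is k'.+1 then let p := alt_aff B A Y X k' (B * x - y - Y) x in (p.2, p.1)
  else (x, y).

Lemma alt_affP i j (A B : R) k v x y :
  alpha D i (av j) = - A -> alpha D j (av i) = - B ->
  alt i j k (v + x *: av i + y *: av j) =
  v + (alt_aff A B (alpha D i v) (alpha D j v) k x y).1 *: av i
    + (alt_aff A B (alpha D i v) (alpha D j v) k x y).2 *: av j.
Proof.
move=> hA hB; elim: k i j A B x y hA hB => [|k IH] i j A B x y hA hB.
  exact: weyl1E.
rewrite [RHS]addrAC; apply: etrans (IH j i B A (B * x - y - alpha D j v) x hB hA).
rewrite altS weylME; congr (alt j i k _).
rewrite srefE; set z := alpha D j _.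
have -> : z = alpha D j v - B * x + 2 * y.
  by rewrite /z !linearD !linearZ /= hB alpha_av /GRing.scale /=; ring.
rewrite [RHS]addrAC -!addrA -scalerBl.
by congr (_ + (_ + _ *: _)); ring.
Qed.

Lemma alt_braid i j (A B : R) k :
  alpha D i (av j) = - A -> alpha D j (av i) = - B ->
  (forall X Y, alt_aff A B X Y k 0 0 =
    ((alt_aff B A Y X k 0 0).2, (alt_aff B A Y X k 0 0).1)) ->
  alt i j k = alt j i k.
Proof.
move=> hA hB e; apply: weylP => v.
have := @alt_affP i j A B k v 0 0 hA hB; have := @alt_affP j i B A k v 0 0 hB hA.
by rewrite !scale0r !addr0 /= e /= => -> ->; rewrite addrAC.
Qed.

(** By integrality, either [A * B >= 4], or [A * B] is 0, 1, 2 or 3 and the two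
reflections satisfy the braid relation of length 2, 3, 4 or 6. The coroot [av
i] stays positive under the alternating products that start with [r j], for all
lengths in the first case, and for lengths less than that of the braid relation
in the second one. *)
Lemma dihedral i j : i != j ->
  let pos k := exists m n : nat, alt i j k (av i) = av i *+ m + av j *+ n in
  (forall k, pos k) \/
  exists m, [/\ (0 < m)%N, alt i j m = alt j i m & forall k, (k < m)%N -> pos k].
Proof.
move=> ij pos; have [A hA] := cartan_nat ij.
have [B hB] : exists B : nat, alpha D j (av i) = - B%:R.
  by apply: cartan_nat; rewrite eq_sym.
have posI k : alt_pos A B k 1 0 -> pos k.
  by move=> /(alt_posP hA hB); rewrite mulr0n addr0.
have braid k := @alt_braid i j A%:R B%:R k hA hB.
have [_ _ _ sym] := alpha_gcm D.
have A0 : A = 0%N -> B = 0%N.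
  move: (sym j i); rewrite hA hB => h AB; move: h; rewrite AB oppr0 => /(_ erefl)/eqP.
  by rewrite oppr_eq0 pnatr_eq0 => /eqP.
have B0 : B = 0%N -> A = 0%N.
  move: (sym i j); rewrite hA hB => h AB; move: h; rewrite AB oppr0 => /(_ erefl)/eqP.
  by rewrite oppr_eq0 pnatr_eq0 => /eqP.
have [AB|AB] := leqP 4 (A * B); first by left => k; apply/posI/alt_pos_inf; rewrite // muln0.
right; move: braid posI => {hA hB}.
have : [\/ (A = 0 /\ B = 0)%N, (A = 1 /\ B = 1)%N,
  ((A = 1 /\ B = 2)%N \/ (A = 2 /\ B = 1)%N) | ((A = 1 /\ B = 3)%N \/ (A = 3 /\ B = 1)%N)].
  have A3 : (A <= 3)%N by nia.
  have B3 : (B <= 3)%N by nia.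
  move: A0 B0 AB A3 B3; clear.
  case: A => [|[|[|[|?]]]]; case: B => [|[|[|[|?]]]] // A0 B0 _ _ _;
    try (by have := A0 erefl); try (by have := B0 erefl);
    by [apply: Or41 | apply: Or42 | apply: Or43; auto | apply: Or44; auto].
case=> [[-> ->]|[-> ->]|[[-> ->]|[-> ->]]|[[-> ->]|[-> ->]]] braid posI;
  [exists 2|exists 3|exists 4|exists 4|exists 6|exists 6];
  (split; [by []|by apply: braid => X Y /=; congr (_, _); ring|
           by move=> k; do 6?[case: k => [|k]] => // _; apply: posI]).
Qed.

End RankTwo.

(** * Signs of real coroots and the exchange condition *)

Section SignCoherence.
Context (R : realType) (V : vectType R) (I : finType) (D : root_datum V I).
Local Notation W := (weyl D).
Local Notation r := (sref D).
Local Notation av := (alphav D).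
Implicit Types (w g h : W) (i j : I) (s t : seq I) (v : V).

(** Induction on the length of [w]. Some [r j] shortens [w]; the factor [alt i
j k] that is split off on the right of [w] is as long as possible, so that the
remaining factor [v] is shortened by neither [r i] nor [r j], and the induction
hypothesis holds for [v (av i)] and [v (av j)]. It remains to see that [alt i j
k] maps [av i] to a positive combination of [av i] and [av j]. This fails only
if [k] is at least the length of a braid relation; but then the braid relation
gives a word of [w] which ends with [i], and [r i] shortens [w]. *)
Lemma posc_ell w i : (ell w <= ell (w * r i)%g)%N -> posc D (w (av i)).
Proof.
have [n] := ubnP (ell w); elim: n w i => // n IH w i; rewrite ltnS => wn wi.
have [->|/eqP w1] := eqVneq w 1%g; first by rewrite weyl1E; apply: posc_av.
have [j wj] := ell_descent w1.
have ij : i != j by apply: contraTneq wj => <-; rewrite -leqNgt.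
pose P k := (ell (w * (alt D i j k)^-1)%g + k)%N == ell w.
have P1 : P 1%N.
  by apply/eqP; rewrite altS mul1g srefV; have := ell_le_mulr w j; lia.
have Pb k : P k -> (k <= ell w)%N by move=> /eqP; lia.
(* the longest alternating product that is a reduced right factor of w *)
have [k /eqP Pk kmax] := ex_maxnP (ex_intro P 1%N P1) Pb.
have k1 := kmax _ P1; set v : W := (w * _)%g in Pk.
have wv : w = (v * alt D i j k)%g by rewrite /v -mulgA mulVg mulg1.
(* the next reflection does not shorten v, by maximality of k; the other one leads back towards w *)
have stop : (ell v <= ell (v * r (if odd k then i else j))%g)%N.
  set x := (v * _)%g; rewrite leqNgt; apply/negP => vx.
  have := ell_le_mulr v (if odd k then i else j); rewrite -/x => vx'.
  suff /kmax : P k.+1 by rewrite ltnn.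
  rewrite /P alt_left invgM srefV mulgA -/v -/x; apply/eqP; lia.
have down : (ell v <= ell (v * r (if odd k then j else i))%g)%N.
  have [l kE] : exists l, k = l.+1 by exists k.-1; lia.
  have -> : (v * r (if odd k then j else i) = w * (alt D i j l)^-1)%g.
    by rewrite /v kE alt_left invgM srefV -[odd l.+1]/(~~ odd l) if_neg -!mulgA srefK mulg1.
  have := ellM (w * (alt D i j l)^-1)%g (alt D i j l).
  have := ell_alt D i j l; rewrite -mulgA mulVg mulg1; lia.
clearbody v; have [vi vj] : (ell v <= ell (v * r i)%g)%N /\ (ell v <= ell (v * r j)%g)%N.
  by move: stop down; case: odd.
have vn : (ell v < n)%N by lia.
have pi := IH _ _ vn vi; have pj := IH _ _ vn vj.
have comb m l : alt D i j k (av i) = av i *+ m + av j *+ l -> posc D (w (av i)).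
  move=> e; rewrite wv weylME e linearD !linearMn /=.
  by apply: poscD; apply: poscMn.
case: (dihedral D ij) => [/(_ k) [m [l]]|[m [m0 br kpos]]]; first exact: comb.
have [/kpos [x [y]]|mk] := ltnP k m; first exact: comb.
have [g gk e] := alt_split D i j m (k - m).
suff : (ell (w * r i)%g < ell w)%N by rewrite ltnNge wi.
case: m m0 br mk e gk {kpos} => // m _ br mk e gk.
rewrite [in ell (_ * _)%g]wv -{1}(subnKC mk) e br altS -!mulgA srefK mulg1.
rewrite -Pk; apply: leq_ltn_trans (ellM _ _) _; rewrite ltn_add2l.
apply: leq_ltn_trans (ellM _ _) _.
apply: leq_ltn_trans (leq_add gk (ell_alt D i j m)) _; lia.
Qed.

Lemma negc_ell w i : (ell (w * r i)%g <= ell w)%N -> posc D (- w (av i)).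
Proof.
move=> wi; have -> : - w (av i) = (w * r i)%g (av i).
  by rewrite weylME sref_av linearN.
by apply: posc_ell; rewrite -mulgA srefK mulg1.
Qed.

Lemma sign_coherence w i : posc D (w (av i)) \/ posc D (- w (av i)).
Proof.
by case: (leqP (ell w) (ell (w * r i)%g)) => [/posc_ell|/ltnW/negc_ell]; [left|right].
Qed.

Lemma weyl_neq0 w v : v != 0 -> w v != 0.
Proof.
apply: contraNneq => wv; have := weylME w^-1%g w v.
by rewrite mulVg weyl1E wv linear0 => ->.
Qed.

(** If the lengths were equal, both [w (av i)] and its opposite would be
positive. *)
Lemma ell_sref_neq w i : ell (w * r i)%g != ell w.
Proof.
apply/eqP => e; have p := @posc_ell w i; rewrite e leqnn in p.
have q := @negc_ell w i; rewrite e leqnn in q.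
by have /eqP := posc_neg (p isT) (q isT); apply/negP/weyl_neq0/av_neq0.
Qed.

Lemma ell_srefl_neq w i : ell (r i * w)%g != ell w.
Proof. by rewrite -ellV invgM srefV -(ellV w) ell_sref_neq. Qed.

Lemma weyl_faithful w : (forall i, w (av i) = av i) -> w = 1%g.
Proof.
move=> wav; have [//|/eqP w1] := eqVneq w 1%g.
have [i /ltnW/negc_ell] := ell_descent w1; rewrite wav => p.
by have /eqP := posc_neg (posc_av D i) p; rewrite (negbTE (av_neq0 D i)).
Qed.

Lemma weyl_coroot_inj g h : (forall i, g (av i) = h (av i)) -> g = h.
Proof.
move=> gh; apply: (mulgI g^-1%g); rewrite mulVg; apply/esym/weyl_faithful => i.
by rewrite weylME -gh -weylME mulVg weyl1E.
Qed.

(** The element [t = w * r i * w^-1 * r j] moves [v] by [f v] times [av j],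
with [f] vanishing at [av j]. Applied to another simple coroot [av k], both [t]
and its inverse keep the coefficient 1 on [av k], so that sign-coherence makes
both [f (av k)] and its opposite nonnegative. Hence [t] fixes all simple
coroots. *)
Lemma sref_conj w i j : w (av i) = av j -> (w * r i = r j * w)%g.
Proof.
move=> wij; apply: (mulIg w^-1%g); rewrite -[RHS]mulgA mulgV mulg1.
apply: (mulIg (r j)); rewrite srefK; set t := (_ * _)%g.
pose f v : R := (alpha D j v : R) - (alpha D i (w^-1%g v) : R).
have tE v : t v = v + f v *: av j.
  rewrite /t !weylME srefE linearB linearZ /= wij.
  rewrite [in RHS]/f; set y := r j v.
  have -> : w (w^-1%g y) = y by rewrite -weylME mulgV weyl1E.
  have wj : w^-1%g (av j) = av i by rewrite -wij -weylME mulVg weyl1E.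
  have uB (u : W) (x z : V) a : u (x - a *: z) = u x - a *: u z by rewrite linearB linearZ.
  have -> : alpha D i (w^-1%g y) = (alpha D i (w^-1%g v) : R) - 2 * (alpha D j v : R).
    rewrite /y srefE uB wj; move: (w^-1%g v) => p.
    by rewrite linearB linearZ /= alpha_av /GRing.scale /= mulrC.
  rewrite /y srefE -addrA -!scaleNr -scalerDl; congr (_ + _ *: _).
  move: (alpha D j v : R) (alpha D i (w^-1%g v) : R) => a b; ring.
have fj : f (av j) = 0.
  have wj : w^-1%g (av j) = av i by rewrite -wij -weylME mulVg weyl1E.
  by rewrite /f wj !alpha_av subrr.
have tVE v : t^-1%g v = v - f v *: av j.
  have tt : t (v - f v *: av j) = v.
    by rewrite linearB linearZ /= !tE fj scale0r addr0 addrK.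
  by rewrite -{1}tt -weylME mulVg weyl1E.
have one_sided g k (a : R) : k != j -> g (av k) = av k + a *: av j -> 0 <= a.
  move=> kj gk; case: (sign_coherence g k).
  - move=> /(posc_coef j); rewrite gk linearD linearZ /= !av_coefE (negbTE kj) eqxx.
    by rewrite add0r /GRing.scale /= mulr1.
  - move=> /(posc_coef k); rewrite gk linearN linearD linearZ /= !av_coefE eqxx.
    by rewrite eq_sym (negbTE kj) /GRing.scale /= mulr0 addr0 oppr_ge0 ler10.
apply: weyl_faithful => k; have [->|kj] := eqVneq k j.
  by rewrite tE fj scale0r addr0.
have fk : 0 <= f (av k) by apply: (one_sided t k) => //; apply: tE.
have fk' : 0 <= - f (av k) by apply: (one_sided t^-1%g k) => //; rewrite scaleNr; apply: tVE.
by rewrite tE (_ : f _ = 0) ?scale0r ?addr0 //; apply/eqP; rewrite eq_le fk andbT -oppr_ge0.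
Qed.

(** The inverse of [wprod s] makes the coroot [av j] negative. Reading [s] from
the left, the sign changes at some letter [i]; just before, the coroot is
positive and [r i] makes it negative, so it is a multiple of [av i], and it is
[av i] itself because it is conjugate to [av j]. Then [sref_conj] applies. *)
Lemma exchange j s : (ell (r j * wprod D s)%g < ell (wprod D s))%N ->
  exists s1 i s2, s = s1 ++ i :: s2 /\ (r j * wprod D s1 = wprod D s1 * r i)%g.
Proof.
rewrite -ellV invgM srefV -[in X in (_ < X)%N -> _]ellV => /ltnW /negc_ell.
elim/last_ind: s => [|s i IH].
  rewrite invg1 weyl1E => p; have /eqP := posc_neg (posc_av D j) p.
  by rewrite (negbTE (av_neq0 D j)).
rewrite wprod_rcons invgM srefV weylME.
set u := (wprod D s)^-1%g in IH *; move=> pN.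
case: (sign_coherence u j) => [[n yn]|/IH [s1 [k [s2 [-> e]]]]]; last first.
  by exists s1, k, (s2 ++ [:: i]); rewrite -cats1 -catA.
have n0 k : k != i -> n k = 0%N.
  move=> ki; have := posc_coef k pN; rewrite srefE linearN linearB linearZ /=.
  rewrite av_coefE eq_sym (negbTE ki) /GRing.scale /= mulr0 subr0 yn av_coef_sum.
  by rewrite oppr_ge0 lern0 => /eqP.
have yi : u (av j) = av i *+ n i.
  by rewrite yn (bigD1 i) //= big1 ?addr0 // => k /n0 ->.
have uK v : u^-1%g (u v) = v by rewrite -weylME mulVg weyl1E.
(* applying the inverse of u gives av j = n i times an integral combination of coroots *)
have ni : n i = 1%N.
  have := congr1 (av_coef D j) (uK (av j)); rewrite yi linearMn linearMn /=.
  rewrite av_coefE eqxx; case: (sign_coherence u^-1%g i) => [[l ->]|[l e]].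
  - by rewrite av_coef_sum -mulrnA => /eqP; rewrite pnatr_eq1 muln_eq1 => /andP[_ /eqP].
  - move=> e1; have : 0 <= - 1 :> R.
      by rewrite -[- 1]/(- true%:R) -e1 -mulNrn -linearN /= e av_coef_sum mulrn_wge0.
    by rewrite oppr_ge0 ler10.
exists s, i, [::]; split; rewrite ?cats1 //; rewrite -[wprod D s]invgK.
apply/esym/sref_conj; rewrite -/u.
by rewrite -[RHS]uK yi ni.
Qed.

End SignCoherence.

(** * Skew group algebras and group algebras *)

Section AdditiveExtension.
Context (K : choiceType) (A N : zmodType) (f : K -> A -> N).
Hypothesis fB : forall k, zmod_morphism (f k).

(** The additive map on finitely supported functions with prescribed values on
the functions supported at one point. *)
Definition addext (z : {malg A[K]}) : N := \sum_(k <- msupp z) f k z@_k.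

Let f0 k : f k 0 = 0.
Proof. by have := fB k 0 0; rewrite !subrr. Qed.

Lemma addextw (d : {fset K}) z : (msupp z `<=` d)%fset ->
  addext z = \sum_(k <- d) f k z@_k.
Proof.
move=> le; rewrite /addext (big_fset_incl _ le) // => k _ /mcoeff_outdom ->.
exact: f0.
Qed.

Lemma addextB : zmod_morphism addext.
Proof.
move=> x y; pose d := (msupp x `|` msupp y)%fset.
rewrite (@addextw d (x - y)) ?msuppB_le //.
rewrite (@addextw d x) ?fsubsetUl // (@addextw d y) ?fsubsetUr //.
by rewrite -sumrB; apply: eq_bigr => k _; rewrite mcoeffB fB.
Qed.

Lemma addextU a k : addext << a *g k >> = f k a.
Proof. by rewrite (addextw msuppU_le) big_seq_fset1 mcoeffUU. Qed.
End AdditiveExtension.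

Section Augmentation.
Context (S : comNzRingType) (G : groupType) (A : comNzRingType).
Context (act : ring_action S G A).
Local Notation skew := (skew_algebra act).
Local Notation mon := (skmon act).
Implicit Types (x y z : skew) (f k : A) (g h : G).

Lemma skmonZ (s : S) f g : s *: mon f g = mon (rbase act s * f) g.
Proof. by rewrite [LHS]skmonM ract1 mul1g. Qed.

Lemma skmon0 g : mon 0 g = 0.
Proof. exact: monalgU0. Qed.

(** The element [x] of the skew group algebra, applied as an operator to the
constant 1. *)
Definition aug : skew -> A := @addext G A A (fun _ f => f).

Fact aug_zmod : zmod_morphism aug.
Proof. exact: addextB. Qed.
HB.instance Definition _ := GRing.isZmodMorphism.Build skew A aug aug_zmod.

Lemma aug_mon f g : aug (mon f g) = f.
Proof. exact: addextU. Qed.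

Lemma augM x y : aug (x * y) = aug (x * mon (aug y) 1%g).
Proof.
elim/skew_ind: x => [f g||x1 x2 IH1 IH2]; last 2 first.
- by rewrite !mul0r.
- by rewrite !mulrDl !raddfD /= IH1 IH2.
elim/skew_ind: y => [k h||y1 y2 IH1 IH2]; last 2 first.
- by rewrite raddf0 skmon0.
- by rewrite raddfD skmonDl !mulrDr !raddfD /= IH1 IH2.
by rewrite aug_mon !skmonM !aug_mon.
Qed.

Lemma augZ (s : S) x : aug (s *: x) = rbase act s * aug x.
Proof.
elim/skew_ind: x => [f g||x1 x2 IH1 IH2].
- by rewrite skmonZ !aug_mon.
- by rewrite scaler0 raddf0 mulr0.
- by rewrite scalerDr !raddfD /= IH1 IH2 mulrDr.
Qed.

Lemma skcoeff_monM f g y h : mcoeff h (mon f g * y) = f * act g (mcoeff (g^-1 * h)%g y).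
Proof.
elim/skew_ind: y => [k g'||y1 y2 IH1 IH2]; last 2 first.
- by rewrite mulr0 !mcoeff0 rmorph0 mulr0.
- by rewrite mulrDr !mcoeffD IH1 IH2 rmorphD mulrDr.
rewrite skmonM !mcoeffU; have [<-|ne] := eqVneq (g * g')%g h.
  by rewrite mulgA mulVg mul1g eqxx.
case: eqP => [e|_]; last by rewrite rmorph0 mulr0.
by rewrite e mulgA mulgV mul1g eqxx in ne.
Qed.

Lemma skcoeffZ (s : S) x g : mcoeff g (s *: x) = rbase act s * mcoeff g x.
Proof. by rewrite [LHS]skcoeff_monM ract1 invg1 mul1g. Qed.

Lemma skcoeff_mon1M f y h : mcoeff h (mon f 1%g * y) = f * mcoeff h y.
Proof. by rewrite skcoeff_monM ract1 invg1 mul1g. Qed.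

Lemma skcoeffM x y h :
  mcoeff h (x * y) = \sum_(g <- msupp x) mcoeff g x * act g (mcoeff (g^-1 * h)%g y).
Proof.
rewrite {1}[x]monalgE mulr_suml raddf_sum /=; apply: eq_bigr => g _.
exact: skcoeff_monM.
Qed.

(** The element [z] of the skew group algebra, applied as an operator to [f];
see [skapplyE]. *)
Definition skapply z f : A := aug (z * mon f 1%g).

Lemma skapply_mon f g k : skapply (mon f g) k = f * act g k.
Proof. by rewrite /skapply skmonM aug_mon. Qed.

Lemma skapply_mon1 f k : skapply (mon f 1%g) k = f * k.
Proof. by rewrite skapply_mon ract1. Qed.

Lemma skapplyDl z y f : skapply (z + y) f = skapply z f + skapply y f.
Proof. by rewrite /skapply mulrDl raddfD. Qed.

Lemma skapplyBl z y f : skapply (z - y) f = skapply z f - skapply y f.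
Proof. by rewrite /skapply mulrBl raddfB. Qed.

Lemma skapplyD z f k : skapply z (f + k) = skapply z f + skapply z k.
Proof. by rewrite /skapply skmonDl mulrDr raddfD. Qed.

Lemma skapply0 z : skapply z 0 = 0.
Proof. by rewrite /skapply skmon0 mulr0 raddf0. Qed.

Lemma skapply0l f : skapply 0 f = 0.
Proof. by rewrite /skapply mul0r raddf0. Qed.

Lemma skapply1 f : skapply 1 f = f.
Proof. by rewrite /skapply mul1r aug_mon. Qed.

Lemma skapplyZl (s : S) z f : skapply (s *: z) f = rbase act s * skapply z f.
Proof. by rewrite /skapply -scalerAl augZ. Qed.

Lemma skapplyZ (s : S) z f : skapply z (rbase act s * f) = rbase act s * skapply z f.
Proof. by rewrite /skapply -skmonZ -scalerAr augZ. Qed.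

Lemma skapplyM z y f : skapply (z * y) f = skapply z (skapply y f).
Proof. by rewrite /skapply -mulrA augM. Qed.

Lemma skapplyE z f : skapply z f = \sum_(g <- msupp z) mcoeff g z * act g f.
Proof.
rewrite {1}[z]monalgE /skapply mulr_suml raddf_sum /=; apply: eq_bigr => g _.
by rewrite [X in aug X]skmonM aug_mon.
Qed.
End Augmentation.

Section Independence.
Context (K : fieldType) (G : eqType) (Y : zmodType) (chi : G -> Y -> K).
Hypothesis chi0 : forall g, chi g 0 = 1.
Hypothesis chiD : forall g l m, chi g (l + m) = chi g l * chi g m.
Hypothesis chi_inj : forall g h, (forall l, chi g l = chi h l) -> g = h.

(** Artin-Dedekind argument: subtracting the relation at [l], multiplied by
[chi g0 l0], from the relation at [l + l0] eliminates the term of [g0]. *)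
Lemma character_independence (s : seq G) (f : G -> K) : uniq s ->
  (forall l, \sum_(g <- s) f g * chi g l = 0) -> forall g, g \in s -> f g = 0.
Proof.
elim: s f => // g0 s IH f /= /andP[g0s us] sum0.
have fs g : g \in s -> f g = 0.
  move=> gs; have g0g : g <> g0 by move=> e; rewrite -e gs in g0s.
  have [l0 lg] : exists l, chi g l <> chi g0 l by apply/existsNP => /chi_inj.
  have : f g * (chi g l0 - chi g0 l0) = 0.
    apply: (IH (fun g => f g * (chi g l0 - chi g0 l0))) => // l.
    transitivity (\sum_(g <- g0 :: s) f g * chi g (l + l0) -
                  \sum_(g <- g0 :: s) f g * chi g l * chi g0 l0); last first.
      by rewrite sum0 -mulr_suml sum0 mul0r subrr.
    rewrite -sumrB big_cons chiD mulrA subrr add0r.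
    by apply: eq_bigr => h _; rewrite chiD; ring.
  by move=> /eqP; rewrite mulf_eq0 subr_eq0 => /orP[/eqP //|/eqP].
move=> g; rewrite inE => /orP[/eqP ->|]; last exact: fs.
have := sum0 0; rewrite big_cons big1_seq ?addr0 => [|h /andP[_ /fs ->]].
  by rewrite chi0 mulr1.
by rewrite mul0r.
Qed.
End Independence.

Section GroupAlgebraCoefficients.
Context (S : comNzRingType) (G : zmodType).
Implicit Types (p q : grpalg S G) (x y : G).

Lemma gcoef0 y : @gcoef S G y 0 = 0.
Proof. exact: mcoeff0. Qed.

Lemma gcoefD y p q : gcoef y (p + q) = gcoef y p + gcoef y q.
Proof. exact: mcoeffD. Qed.

Lemma gcoefB y p q : gcoef y (p - q) = gcoef y p - gcoef y q.
Proof. exact: mcoeffB. Qed.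

Lemma gcoef_gmon y a x : @gcoef S G y (gmon a x) = a *+ (x == y).
Proof. exact: mcoeffU. Qed.

(** The product of a Laurent polynomial with a formal series that has no
condition on its support. *)
Definition series_action p (F : G -> S) y := \sum_(x <- msupp p) gcoef x p * F (y - x).

Fact series_actionB F y : zmod_morphism (fun p => series_action p F y).
Proof.
apply: (@addextB (Algebra.to_multiplicative G) S S (fun x a => a * F (y - x))).
by move=> x a b; rewrite mulrBl.
Qed.

Lemma series_action_gmon a x F y : series_action (gmon a x) F y = a * F (y - x).
Proof.
apply: (@addextU (Algebra.to_multiplicative G) S S (fun x a => a * F (y - x))).
by move=> z c d; rewrite mulrBl.
Qed.

Lemma series_action1 F y : series_action 1 F y = F y.
Proof. by rewrite [LHS]series_action_gmon mul1r subr0. Qed.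

Lemma series_action_step p F x y : series_action ((1 - gmon 1 x) * p) F y =
  series_action p (fun y => F y - F (y - x)) y.
Proof.
have act0 H : series_action 0 H y = 0.
  by have := series_actionB H y 0 0; rewrite !subrr.
have actD H p1 p2 : series_action (p1 + p2) H y = series_action p1 H y + series_action p2 H y.
  have := series_actionB H y (p1 + p2) p2; rewrite addrK => ->.
  by rewrite subrK.
elim/grpalg_ind: p => [a z||p1 p2 IH1 IH2]; last 2 first.
- by rewrite mulr0 !act0.
- by rewrite mulrDr !actD IH1 IH2.
rewrite mulrBl mul1r gmonM mul1r series_actionB !series_action_gmon.
by rewrite mulrBr opprD addrA addrAC.
Qed.

Lemma gmon_inversion_inj (p : {malg S[G]}) :
  \sum_(m <- msupp p) gmon (mcoeff m p) (- m) = 0 :> grpalg S G -> p = 0.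
Proof.
move=> p0; apply/malgP => l; rewrite mcoeff0.
have := congr1 (gcoef (- l)) p0; rewrite gcoef0 /gcoef raddf_sum /= => sum0.
have [ls|/mcoeff_outdom //] := boolP (l \in msupp p).
rewrite -[RHS]sum0 (bigD1_seq l) ?fset_uniq //= mcoeffUU big1 ?addr0 // => m ml.
by rewrite mcoeffU; case: eqP => // /oppr_inj e; rewrite e eqxx in ml.
Qed.
End GroupAlgebraCoefficients.

(** The coefficient at 0 is 1 or 2. *)
Lemma gmon_mul_add1_neq0 (G : zmodType) (x y : G) :
  gmon 1 x * gmon 1 y + 1 != 0 :> grpalg int G.
Proof.
rewrite gmonM mulr1; apply/eqP => /(congr1 (gcoef 0)).
by rewrite gcoef0 gcoefD !gcoef_gmon eqxx; case: eqP.
Qed.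

(** The numerator of [c_fun] over the denominator [1 - z ^+ 2]. *)
Lemma c_fun_neq0_num (K : fieldType) (t t' u u' z z2 : K) :
  t^-1 = t' -> u^-1 = u' -> z ^+ 2 = z2 -> 1 - z2 != 0 ->
  t' - (u - u') * z - t * z2 != 0 -> c_fun t u z != 0.
Proof.
rewrite /c_fun /b_fun => -> -> -> z0 n0.
have -> : t - (t - t' + (u - u') * z) / (1 - z2) =
    (t' - (u - u') * z - t * z2) / (1 - z2) by field.
by rewrite mulf_neq0 ?invr_eq0.
Qed.

Lemma b_fun_morph (K K' : fieldType) (phi : {rmorphism K -> K'}) t u z :
  phi (b_fun t u z) = b_fun (phi t) (phi u) (phi z).
Proof.
by rewrite /b_fun fmorph_div rmorphD !rmorphB rmorphM rmorphB !fmorphV rmorph1 rmorphXn.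
Qed.

Section GroupAlgebraFractions.
Context (S : idomainType) (G : linordZmodType).
Local Notation Z := (grpalg S G).
Local Notation "x %:F" := (FracField.tofrac x).
Local Notation ct a := (gconst G a : Z)%:F.
Local Notation ex y := (gmon 1 y : Z)%:F.
Implicit Types (x y : G) (a t u : S).

Lemma ex0 : ex 0 = 1.
Proof. exact: tofrac1. Qed.

Lemma exD x y : ex (x + y) = ex x * ex y.
Proof. by rewrite -tofracM gmonM mul1r. Qed.

Lemma ct1 : ct 1 = 1.
Proof. exact: tofrac1. Qed.

Lemma ctM a t : ct (a * t) = ct a * ct t.
Proof. by rewrite -tofracM gmonM addr0. Qed.

Lemma ctB a t : ct (a - t) = ct a - ct t.
Proof. by rewrite -tofracB; congr (_%:F); exact: raddfB. Qed.

Lemma tofrac_gmon a y : (gmon a y : Z)%:F = ct a * ex y.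
Proof. by rewrite -tofracM gmonM mulr1 add0r. Qed.

Lemma tofrac_expE (p : Z) : p%:F = \sum_(m <- msupp p) ct (gcoef m p) * ex m.
Proof.
rewrite {1}[p]monalgE rmorph_sum /=; apply: eq_bigr => m _.
exact: tofrac_gmon.
Qed.

Definition grpalg_opp : {rmorphism Z -> Z} := @grpalg_map S G G -%R.

Lemma grpalg_opp_inj : injective grpalg_opp.
Proof.
apply: (can_inj (g := grpalg_opp)) => p; rewrite /grpalg_opp /= -grpalg_map_comp.
rewrite -[RHS]grpalg_map_id; apply: eq_grpalg_map => y; exact: opprK.
Qed.

(** The involution e^y |-> e^(- y), extended to fractions. It is needed because
the Bernstein-Lusztig relation is written with e^lambda, whereas Z^lambda is to
be mapped to e^(- lambda). *)
Lemma exponent_inversion : exists phi : {rmorphism {fraction Z} -> {fraction Z}},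
  (forall y, phi (ex y) = ex (- y)) /\ (forall a, phi (ct a) = ct a).
Proof.
exists (fracmap_rmorphism grpalg_opp_inj); split=> [l|a].
- apply: etrans (fracmap_tofrac grpalg_opp_inj _) (congr1 _ _).
  exact: grpalg_map_gmon.
- apply: etrans (fracmap_tofrac grpalg_opp_inj _) (congr1 _ _).
  by apply: etrans (grpalg_map_gmon _ _ _) _; rewrite raddf0.
Qed.

Lemma b_fun_inversion (p : Z) t u y x z :
  p%:F = b_fun (ct t) (ct u) (ex (- y)) * (ex x - ex z) ->
  \sum_(m <- msupp p) ct (gcoef m p) * ex (- m) =
  b_fun (ct t) (ct u) (ex y) * (ex (- x) - ex (- z)).
Proof.
have [phi [phi_ex phi_ct]] := exponent_inversion.
move=> /(congr1 phi); rewrite tofrac_expE (raddf_sum phi) /= => pE.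
apply: etrans (etrans pE _).
  by apply: eq_bigr => m _; rewrite (rmorphM phi) phi_ct phi_ex.
rewrite (rmorphM phi) (rmorphB phi) !phi_ex; congr (_ * _).
by apply: etrans (b_fun_morph phi _ _ _) _; rewrite !phi_ct phi_ex opprK.
Qed.

Lemma ex_free (p : {malg S[G]}) :
  \sum_(m <- msupp p) ct (mcoeff m p) * ex (- m) = 0 -> p = 0.
Proof.
move=> p0; apply: gmon_inversion_inj; apply/eqP.
rewrite -tofrac_eq0 rmorph_sum /=; apply/eqP; rewrite -[RHS]p0.
by apply: eq_bigr => m _; exact: tofrac_gmon.
Qed.

Lemma one_sub_gmon_neq0 y : y != 0 -> 1 - gmon 1 y != 0 :> Z.
Proof.
move=> y0; apply/eqP => /(congr1 (gcoef 0)).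
rewrite gcoefB !gcoef_gmon gcoef0 eqxx (negbTE y0) subr0 => /eqP.
by rewrite oner_eq0.
Qed.

Lemma ctV a : a \is a GRing.unit -> (ct a)^-1 = ct a^-1.
Proof.
move=> aU; have a0 : ct a != 0.
  rewrite tofrac_eq0; apply: contraTneq aU => a0.
  have <- : gcoef 0 (gconst G a) = a by rewrite gcoef_gmon eqxx.
  by rewrite a0 gcoef0 unitr0.
by apply: (mulfI a0); rewrite divff // -ctM mulrV // ct1.
Qed.

(** Over the denominator [1 - e^(2 y)], the numerator has the constant
coefficient [t^-1]. *)
Lemma c_fun_neq0 t u y : t \is a GRing.unit -> u \is a GRing.unit ->
  y != 0 -> y + y != 0 -> c_fun (ct t) (ct u) (ex y) != 0.
Proof.
move=> tU uU /negbTE y0 yy0.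
have ex2 : ex y ^+ 2 = ex (y + y) by rewrite exD expr2.
apply: (c_fun_neq0_num (ctV tU) (ctV uU) ex2).
  by rewrite -tofrac1 -tofracB tofrac_eq0 one_sub_gmon_neq0.
rewrite -ctB -[ct t^-1]mulr1 -ex0 -!tofrac_gmon.
rewrite -!tofracB tofrac_eq0; apply/eqP => /(congr1 (gcoef 0)).
rewrite !gcoefB gcoef0 !gcoef_gmon eqxx y0 (negbTE yy0) !subr0 => /eqP.
by apply/negP; rewrite invr_eq0; apply: contraTneq tU => ->; rewrite unitr0.
Qed.
End GroupAlgebraFractions.

(** * The principal representation of the Hecke algebra *)

(** The field [A] stands for the fractions of Laurent polynomials and [e l] for
e^(- l), the image of [Z^l]. The construction only depends on the action of [W]
on the [e l], on their independence over [S], and on the two properties [sg_sg]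
and [c_neq0] of the parameters. *)
Section PrincipalRepresentation.
Context (R : realType) (V : vectType R) (I : finType) (D : root_datum V I).
Local Notation W := (weyl D).
Local Notation r := (sref D).
Context (S : idomainType) (A : fieldType) (act : ring_action S W A).
Context (Y : zmodType) (aY : W -> Y -> Y) (e : Y -> A).
Context (sg : I -> S) (b : I -> A) (H : algType S) (ZH : Y -> W -> H).
Local Notation mon := (skmon act).
Local Notation skew := (skew_algebra act).
Local Notation rb := (rbase act).
Local Notation c := (fun i => rb (sg i) - b i).

Hypothesis e0 : e 0 = 1.
Hypothesis eD : forall l m, e (l + m) = e l * e m.
Hypothesis act_e : forall w l, act w (e l) = e (aY w l).
Hypothesis aY_faithful : forall g h, (forall l, aY g l = aY h l) -> g = h.
Hypothesis e_free : forall p : {malg S[Y]},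
  \sum_(m <- msupp p) rb (mcoeff m p) * e m = 0 -> p = 0.

Hypothesis sg_unit : forall i, sg i \is a GRing.unit.
Hypothesis sg_sg : forall i j, sg i * sg j + 1 != 0.
Hypothesis c_neq0 : forall i, c i != 0.

Hypothesis H_basis : forall h : H, exists! a : {malg S[(Y * W)%type]},
  h = \sum_(k <- msupp a) mcoeff k a *: ZH k.1 k.2.
Hypothesis H_unity : ZH 0 1%g = 1.
Hypothesis H_ZH : forall l w, ZH l 1%g * ZH 0 w = ZH l w.
Hypothesis H_up : forall i w, (ell w < ell (r i * w)%g)%N ->
  ZH 0 (r i) * ZH 0 w = ZH 0 (r i * w)%g.
Hypothesis H_down : forall i w, (ell (r i * w)%g < ell w)%N ->
  ZH 0 (r i) * ZH 0 w = (sg i - (sg i)^-1) *: ZH 0 w + ZH 0 (r i * w)%g.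
Hypothesis H_ZZ : forall l m, ZH l 1%g * ZH m 1%g = ZH (l + m) 1%g.
Hypothesis H_HZ : forall i l, exists2 p : grpalg S Y,
  \sum_(m <- msupp p) rb (gcoef m p) * e m = b i * (e l - e (aY (r i) l)) &
  ZH 0 (r i) * ZH l 1%g - ZH (aY (r i) l) 1%g * ZH 0 (r i) =
  \sum_(m <- msupp p) gcoef m p *: ZH m 1%g.

Implicit Types (i j : I) (l m : Y) (w g : W) (s t : seq I) (h x : H) (z : skew).

Local Notation coords := {malg S[(Y * W)%type]}.
Local Notation HW w := (ZH 0 w).
Local Notation Hi i := (ZH 0 (r i)).

Section Extension.
Context (N : lmodType S) (t : Y * W -> N).

Definition coext : coords -> N := addext (fun k a => a *: t k).

Fact coext_zmod : zmod_morphism coext.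
Proof. by apply: addextB => k x y; rewrite scalerBl. Qed.
HB.instance Definition _ := GRing.isZmodMorphism.Build coords N coext coext_zmod.

Lemma coextU a k : coext << a *g k >> = a *: t k.
Proof. by apply: addextU => k' x y; rewrite scalerBl. Qed.

Lemma coextZ a (u : coords) : coext (a *: u) = a *: coext u.
Proof.
have fB k : zmod_morphism (fun a' : S => a' *: t k) by move=> x y; rewrite scalerBl.
rewrite /coext (addextw fB (msuppZ_le a u)) /addext scaler_sumr.
by apply: eq_bigr => k _; rewrite mcoeffZ scalerA.
Qed.
End Extension.

Local Notation hcomb := (coext (fun k => ZH k.1 k.2)).

(** The coordinates in the basis [ZH]; linear maps on [H] are given by their
values on the basis, see [hext]. *)
Definition hcoord h : coords := projT1 (cid (H_basis h)).

Lemma hcoordK h : hcomb (hcoord h) = h.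
Proof. by rewrite /hcoord; case: cid => a [ha _] /=; rewrite [RHS]ha. Qed.

Lemma hcombK a : hcoord (hcomb a) = a.
Proof. by rewrite /hcoord; case: cid => a' [_ u] /=; apply: u. Qed.

Lemma hcoordU l w : hcoord (ZH l w) = << 1 *g (l, w) >>.
Proof. by rewrite -[RHS]hcombK coextU scale1r. Qed.

Lemma hcoord_zmod : zmod_morphism hcoord.
Proof. by move=> x y; rewrite -[RHS]hcombK raddfB /= !hcoordK. Qed.

HB.instance Definition _ := GRing.isZmodMorphism.Build H coords hcoord hcoord_zmod.

Lemma hcoordZ a h : hcoord (a *: h) = a *: hcoord h.
Proof. by rewrite -[RHS]hcombK coextZ hcoordK. Qed.

Lemma hecke_ind (P : H -> Prop) :
  (forall l w, P (ZH l w)) -> P 0 -> (forall x y, P x -> P y -> P (x + y)) ->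
  (forall a x, P x -> P (a *: x)) -> forall x, P x.
Proof.
move=> PU P0 PD PZ x; rewrite -[x]hcoordK /coext /addext.
by elim/big_ind: _ => // k _; apply/PZ/PU.
Qed.

Section HeckeExtension.
Context (N : lmodType S) (t : Y * W -> N).

Definition hext h : N := coext t (hcoord h).

Lemma hextU l w : hext (ZH l w) = t (l, w).
Proof. by rewrite /hext hcoordU coextU scale1r. Qed.

Fact hext_linear : linear hext.
Proof.
by move=> a x y; rewrite /hext (raddfD hcoord) /= hcoordZ (raddfD (coext t)) /= coextZ.
Qed.
HB.instance Definition _ := GRing.isLinear.Build S H N *:%R hext hext_linear.
End HeckeExtension.

Lemma ZH_free a l w : a *: ZH l w = 0 -> a = 0.
Proof.
move=> /(congr1 hcoord); rewrite hcoordZ hcoordU raddf0.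
by move=> /(congr1 (mcoeff (l, w))); rewrite mcoeffZ mcoeffUU mulr1 mcoeff0.
Qed.

Definition Hword s : H := foldr (fun i x => Hi i * x) 1 s.

Lemma Hword_rcons s i : Hword (rcons s i) = Hword s * Hi i.
Proof. by elim: s => [|j s IH] /=; rewrite ?mul1r ?mulr1 // IH mulrA. Qed.

Lemma Hword_reduced s : reduced D s -> HW (wprod D s) = Hword s.
Proof.
elim: s => [|i s IH] red_is /=; first exact: H_unity.
have [_ red_s] := reduced_catP (red_is : reduced D ([:: i] ++ s)).
rewrite -IH // H_up //; have := red_is; rewrite /reduced /= => ->.
by rewrite red_s.
Qed.

Lemma Hi_quadratic i : Hi i * Hi i = (sg i - (sg i)^-1) *: Hi i + 1.
Proof.
rewrite H_down ?srefK ?H_unity // ell1 lt0n.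
by have := ell_sref_neq (1%g : W) i; rewrite mul1g ell1.
Qed.

(** Both [Hi j * Hword s] and [Hword s * Hi i] are the basis element of [r j *
wprod s]. Multiplying this equality by [Hi j] on the left, the quadratic
relations give [sg j - (sg j)^-1 = sg i - (sg i)^-1] by freeness of the basis,
and [(sg j - sg i) * (sg i * sg j + 1)] is zero. *)
Lemma sg_conj i j s : reduced D (j :: s) -> reduced D (rcons s i) ->
  (r j * wprod D s = wprod D s * r i)%g -> sg j = sg i.
Proof.
move=> red_js red_si com.
have [_ red_s] := reduced_catP (red_js : reduced D ([:: j] ++ s)).
have comH : Hi j * Hword s = Hword s * Hi i.
  rewrite -Hword_rcons -(Hword_reduced red_si) wprod_rcons -com.
  exact/esym/(Hword_reduced red_js).
have : (sg j - (sg j)^-1) *: HW (wprod D (j :: s)) = (sg i - (sg i)^-1) *: HW (wprod D (j :: s)).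
  have : Hi j * (Hi j * Hword s) = Hword s * (Hi i * Hi i) by rewrite comH !mulrA comH.
  rewrite mulrA !Hi_quadratic mulrDl mulrDr mul1r mulr1 => /addIr.
  by rewrite -scalerAl -scalerAr -comH (Hword_reduced red_js).
move/eqP; rewrite -subr_eq0 -scalerBl => /eqP /ZH_free /eqP.
rewrite subr_eq0 => /eqP eqA.
have : (sg j - sg i) * (sg i * sg j + 1) = 0.
  have Vi := mulrV (sg_unit i); have Vj := mulrV (sg_unit j).
  have -> : (sg j - sg i) * (sg i * sg j + 1) =
    (sg i * sg j) * ((sg j - (sg j)^-1) - (sg i - (sg i)^-1)) +
    sg i * (sg j / sg j - 1) - sg j * (sg i / sg i - 1) by ring.
  by rewrite eqA Vi Vj !subrr !mulr0 !addr0 subr0.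
move/eqP; rewrite mulf_eq0 (negbTE (sg_sg i j)) orbF subr_eq0.
by move/eqP.
Qed.

Definition sgprod s : S := \prod_(i <- s) sg i.

(** Induction on the length. If [t] starts with [j], the exchange condition
rewrites [s = s1 ++ i :: s2] as [j :: s1 ++ s2], another reduced word of the
same element; it has the same product as [s] by [sg_conj], and as [t] by
induction. *)
Lemma sgprod_reduced s t : reduced D s -> reduced D t ->
  wprod D s = wprod D t -> sgprod s = sgprod t.
Proof.
elim: t s => [|j t IH] s red_s red_t st.
  by move: red_s; rewrite /reduced st ell1 => /esym/size0nil ->.
have sz : size s = (size t).+1 by rewrite -red_s st red_t.
have tE : wprod D t = (r j * wprod D s)%g by rewrite st /= mulgA srefK mul1g.
have [|s1 [i [s2 [sE com]]]] := @exchange _ _ _ D j s.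
  by rewrite -tE red_s sz ltnS ell_le.
have sE' : wprod D s = wprod D ((j :: s1) ++ s2).
  by rewrite sE !wprod_cat /= mulgA -com.
have tE' : wprod D (s1 ++ s2) = wprod D t.
  by rewrite tE sE' /= mulgA srefK mul1g.
have sz' : size (s1 ++ s2) = size t.
  by move: sz; rewrite sE !size_cat /= addnS => -[].
have [_ red_t'] := reduced_catP (red_t : reduced D ([:: j] ++ t)).
have /IH/(_ red_t' tE') e12 : reduced D (s1 ++ s2) by rewrite /reduced tE' sz'.
have [red_js _] : reduced D (j :: s1) /\ reduced D s2.
  by apply: reduced_catP; rewrite /reduced -sE' red_s sz -sz'.
have [red_si _] : reduced D (rcons s1 i) /\ reduced D s2.
  by apply: reduced_catP; rewrite cat_rcons -sE.
rewrite /sgprod sE big_cat !big_cons /= (sg_conj red_js red_si com).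
by move: e12; rewrite /sgprod big_cat /= => <-; rewrite mulrCA.
Qed.

Definition redword w : seq I := s2val (cid2 (ell_word w)).

Lemma redwordK w : wprod D (redword w) = w.
Proof. by rewrite /redword; case: cid2. Qed.

Lemma redword_reduced w : reduced D (redword w).
Proof. by rewrite /reduced redwordK /redword; case: cid2. Qed.

Lemma redword_size w : size (redword w) = ell w.
Proof. by rewrite -redword_reduced redwordK. Qed.

(** The trivial character of the span of the [ZH 0 w]; it is multiplicative by
[vac_HiHW]. *)
Definition chi w : S := sgprod (redword w).

Lemma chi_up i w : (ell w < ell (r i * w)%g)%N -> chi (r i * w)%g = sg i * chi w.
Proof.
move=> up; have red_iw : reduced D (i :: redword w).
  apply/eqP; rewrite eqn_leq ell_le /= redword_size redwordK.
  exact: up.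
rewrite /chi (@sgprod_reduced _ (i :: redword w)) ?redwordK //.
- by rewrite /sgprod big_cons.
- exact: redword_reduced.
- by rewrite /= redwordK.
Qed.

Lemma chi_down i w : (ell (r i * w)%g < ell w)%N -> chi w = sg i * chi (r i * w)%g.
Proof.
by move=> down; rewrite -chi_up mulgA srefK mul1g.
Qed.

(** The projection of [H] onto the module induced from [chi], realized in the
field [A]. *)
Definition vac x : A := aug (hext (fun k => mon (rb (chi k.2) * e k.1) 1%g) x).

Fact vac_zmod : zmod_morphism vac.
Proof. by move=> x y; rewrite /vac linearB raddfB. Qed.
HB.instance Definition _ := GRing.isZmodMorphism.Build H A vac vac_zmod.

Lemma vacD x y : vac (x + y) = vac x + vac y.
Proof. exact: (raddfD vac). Qed.

Lemma vacZ a x : vac (a *: x) = rb a * vac x.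
Proof. by rewrite /vac linearZ augZ. Qed.

Lemma vacU l w : vac (ZH l w) = rb (chi w) * e l.
Proof. by rewrite /vac hextU aug_mon. Qed.

Local Notation skapply := (skapply (act := act)).

(** Left multiplication by [h] induces on the principal module the operator
given by [z]. *)
Definition acts_as h z := forall x, vac (h * x) = skapply z (vac x).

Lemma acts_as1 : acts_as 1 1.
Proof. by move=> x; rewrite mul1r skapply1. Qed.

Lemma acts_asM h h' z z' : acts_as h z -> acts_as h' z' -> acts_as (h * h') (z * z').
Proof. by move=> hz hz' x; rewrite -mulrA hz hz' skapplyM. Qed.

Lemma acts_as_basis h z : (forall l w, vac (h * ZH l w) = skapply z (vac (ZH l w))) ->
  acts_as h z.
Proof.
move=> hz; elim/hecke_ind => [//||x y hx hy|a x hx].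
- by rewrite mulr0 !raddf0 skapply0.
- by rewrite mulrDr !vacD hx hy skapplyD.
- by rewrite -(scalerAr a h x) !vacZ hx skapplyZ.
Qed.

Definition PsiZ l : skew := mon (e l) 1%g.
Definition PsiH i : skew := mon (c i) (r i) + mon (b i) 1%g.
Definition PsiW s : skew := foldr (fun i z => PsiH i * z) 1 s.

Lemma acts_as_Z l : acts_as (ZH l 1%g) (PsiZ l).
Proof.
apply: acts_as_basis => m w; rewrite -(H_ZH m) mulrA H_ZZ !H_ZH !vacU.
by rewrite skapply_mon1 eD mulrCA.
Qed.

(** When [r i] shortens [w], this is the identity (q - 1/q) q + 1 = q^2 for q =
[sg i]. *)
Lemma vac_HiHW i w : vac (Hi i * HW w) = rb (sg i) * rb (chi w).
Proof.
have := ell_srefl_neq w i; rewrite neq_ltn => /orP[down|up].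
  rewrite H_down // vacD vacZ !vacU e0 !mulr1 -!rmorphM -rmorphD.
  congr (rb _); rewrite (chi_down down); have Vi := mulrV (sg_unit i).
  set q := chi _.
  have -> : (sg i - (sg i)^-1) * (sg i * q) + q =
    sg i * (sg i * q) - q * (sg i / sg i - 1) by ring.
  by rewrite Vi subrr mulr0 subr0.
by rewrite H_up // vacU e0 mulr1 chi_up // rmorphM.
Qed.

Lemma skapply_PsiH i f : skapply (PsiH i) f = c i * act (r i) f + b i * f.
Proof. exact: etrans (skapplyDl _ _ _) (congr2 +%R (skapply_mon _ _ _ _) (skapply_mon1 _ _ _)). Qed.

(** The Bernstein-Lusztig relation moves [Hi i] to the right of [Z^l], where it
meets [HW w] and becomes the scalar [sg i] of the trivial character; the
remaining terms are [b i] times the difference of the exponentials. *)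
Lemma acts_as_H i : acts_as (Hi i) (PsiH i).
Proof.
apply: acts_as_basis => l w.
have [p pE HZ] := H_HZ i l.
have -> : Hi i * ZH l w = ZH (aY (r i) l) 1%g * (Hi i * HW w) +
    (\sum_(m <- msupp p) gcoef m p *: ZH m 1%g) * HW w.
  by rewrite -HZ mulrBl mulrA addrC subrK -mulrA H_ZH.
have vac_sum : vac ((\sum_(m <- msupp p) gcoef m p *: ZH m 1%g) * HW w) =
    rb (chi w) * (b i * (e l - e (aY (r i) l))).
  rewrite -pE mulr_sumr mulr_suml (raddf_sum vac) /=; apply: eq_bigr => m _.
  by rewrite -(scalerAl _ (ZH m 1%g)) H_ZH vacZ vacU mulrCA.
rewrite vacD vac_sum (acts_as_Z (aY (r i) l) (Hi i * HW w)) vac_HiHW vacU.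
rewrite skapply_PsiH (rmorphM (act (r i)) (rb (chi w)) (e l)) (ract_base act) act_e.
rewrite (_ : skapply (PsiZ _) _ = e (aY (r i) l) * (rb (sg i) * rb (chi w))); first ring.
exact: skapply_mon1.
Qed.

Lemma acts_as_word s : acts_as (Hword s) (PsiW s).
Proof.
elim: s => [|i s IH]; first exact: acts_as1.
exact: acts_asM (acts_as_H i) IH.
Qed.

Definition Psi_basis (k : Y * W) : skew := PsiZ k.1 * PsiW (redword k.2).

Local Notation Psi := (hext Psi_basis).

Lemma acts_as_Psi h : acts_as h (Psi h).
Proof.
elim/hecke_ind: h => [l w||h h' IH IH'|a h IH] x.
- rewrite hextU -(H_ZH l) -{1}(redwordK w) (Hword_reduced (redword_reduced w)).
  exact: acts_asM (acts_as_Z l) (acts_as_word (redword w)) x.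
- by rewrite linear0 mul0r raddf0 skapply0l.
- by rewrite linearD mulrDl vacD IH IH' skapplyDl.
- by rewrite linearZ -(scalerAl a h x) vacZ IH skapplyZl.
Qed.

Lemma e_inj : injective e.
Proof.
move=> l m lm; have : << 1 *g l >> - << 1 *g m >> = 0 :> {malg S[Y]}.
  apply: e_free; rewrite -/(addext (fun m a => rb a * e m) _).
  have fB (k : Y) : zmod_morphism (fun a : S => rb a * e k).
    by move=> x y; rewrite rmorphB mulrBl.
  by rewrite (addextB fB) !(addextU fB) lm subrr.
move=> /(congr1 (mcoeff l)); rewrite mcoeffB mcoeff0 !mcoeffU eqxx.
by case: eqP => // _ /eqP; rewrite subr0 oner_eq0.
Qed.

Lemma skapply_faithful z : (forall l, skapply z (e l) = 0) -> z = 0.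
Proof.
move=> z0; apply/malgP => w; rewrite mcoeff0.
have [ws|/mcoeff_outdom //] := boolP (w \in msupp z).
apply: (@character_independence _ _ _ (fun g l => act g (e l)) _ _ _
  (msupp z) (fun w => mcoeff w z)) => //.
- by move=> g; rewrite e0 rmorph1.
- by move=> g l m; rewrite eD rmorphM.
- move=> g h gh; apply: aY_faithful => l.
  by apply: e_inj; rewrite -!act_e.
- exact: fset_uniq.
- by move=> l; rewrite -[RHS](z0 l) skapplyE.
Qed.

Lemma chi1 : chi 1%g = 1.
Proof.
by rewrite /chi; have := redword_size 1%g; rewrite ell1 => /size0nil ->; rewrite /sgprod big_nil.
Qed.

(** The vectors [ZH l 1] of [H] are mapped by [vac] to the [e l], which is
enough to tell operators apart. *)
Lemma acts_as_inj h z z' : acts_as h z -> acts_as h z' -> z = z'.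
Proof.
move=> hz hz'; apply/eqP; rewrite -subr_eq0; apply/eqP/skapply_faithful => l.
have := hz (ZH l 1%g); have := hz' (ZH l 1%g); rewrite vacU chi1 rmorph1 mul1r.
by move=> -> e12; rewrite skapplyBl -e12 subrr.
Qed.

Fact Psi_monoid : monoid_morphism Psi.
Proof.
split; first exact: acts_as_inj (acts_as_Psi 1) acts_as1.
move=> h h'; apply: acts_as_inj (acts_as_Psi _) _.
by apply: acts_asM; apply: acts_as_Psi.
Qed.

Lemma Psi_Hi i : Psi (Hi i) = PsiH i.
Proof. exact: acts_as_inj (acts_as_Psi _) (acts_as_H i). Qed.

Lemma Psi_Z l : Psi (ZH l 1%g) = PsiZ l.
Proof. exact: acts_as_inj (acts_as_Psi _) (acts_as_Z l). Qed.

(** The coefficient at [wprod s] of [PsiW s], for a reduced word [s]. *)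
Fixpoint lead s : A := if s is i :: s' then c i * act (r i) (lead s') else 1.

Lemma lead_neq0 s : lead s != 0.
Proof.
elim: s => [|i s IH] /=; first exact: oner_neq0.
by rewrite mulf_neq0 ?fmorph_eq0.
Qed.

Lemma coeff_PsiH i (z : skew) w : mcoeff w (PsiH i * z) =
  c i * act (r i) (mcoeff (r i * w)%g z) + b i * mcoeff w z.
Proof.
rewrite mulrDl mcoeffD; congr (_ + _); last exact: skcoeff_mon1M.
by apply: etrans (skcoeff_monM _ _ _ _) _; rewrite srefV.
Qed.

(** Expanding the product, all the terms other than the one of the whole word
are supported at products of proper subwords, which are shorter. *)
Lemma coeff_PsiW s w : (size s <= ell w)%N ->
  mcoeff w (PsiW s) = if wprod D s == w then lead s else 0.
Proof.
elim: s w => [|i s IH] w sw.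
  by apply: etrans (mcoeffU _ _ _) _; rewrite [wprod D [::]]/=; case: ifP.
rewrite coeff_PsiH (IH w (ltnW sw)).
have -> : (wprod D s == w) = false.
  by apply/negbTE; apply: contraTneq sw => <-; rewrite -ltnNge ltnS ell_le.
rewrite mulr0 addr0 IH; last by rewrite -ltnS (leq_trans sw) ?ell_le_mull.
have -> : (wprod D s == r i * w)%g = (wprod D (i :: s) == w).
  by apply/eqP/eqP => [/= ->|<-] /=; rewrite mulgA srefK mul1g.
by case: ifP => _ //; rewrite rmorph0 mulr0.
Qed.

Lemma coeff_Psi_basis (k : Y * W) w : (ell k.2 <= ell w)%N ->
  mcoeff w (Psi_basis k) = if k.2 == w then e k.1 * lead (redword w) else 0.
Proof.
move=> kw; apply: etrans (skcoeff_mon1M _ _ _) _.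
rewrite coeff_PsiW ?redword_size // redwordK.
by case: eqP => [->|_] //; rewrite mulr0.
Qed.

Lemma coeff_Psi h w :
  mcoeff w (Psi h) = \sum_(k <- msupp (hcoord h)) rb (mcoeff k (hcoord h)) * mcoeff w (Psi_basis k).
Proof.
rewrite /hext /coext /addext raddf_sum; apply: eq_bigr => k _.
exact: skcoeffZ.
Qed.

(** If [w] has maximal length in the support of [h], then the coefficient of
[Psi h] at [w] only involves the basis elements [ZH l w]; it is [lead] times a
combination of the [e l], which are independent. This is iterated downwards on
the length, starting from a bound [N] of the lengths that occur. *)
Lemma Psi_ker h : Psi h = 0 -> h = 0.
Proof.
move=> h0; set a := hcoord h.
suff a0 : a = 0 by rewrite -[h]hcoordK -/a a0 raddf0.
pose N := \max_(k <- msupp a) ell k.2.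
suff vanish n k : (N < ell k.2 + n)%N -> mcoeff k a = 0.
  apply/malgP => k; rewrite mcoeff0; apply: (vanish N.+1).
  by rewrite addnS ltnS leq_addl.
elim: n k => [|n IH] [l w] /= kN.
  apply: mcoeff_outdom; apply: contraL kN => ks; rewrite addn0 -leqNgt.
  exact: (@leq_bigmax_seq _ _ predT (fun k : Y * W => ell k.2) (l, w) ks isT).
(* the part of h that lies on the basis elements ZH l w, as a Laurent polynomial *)
pose p : {malg S[Y]} := \sum_(k <- msupp a | k.2 == w) << mcoeff k a *g k.1 >>.
have fB (m : Y) : zmod_morphism (fun u : S => rb u * e m).
  by move=> x y; rewrite rmorphB mulrBl.
have p0 : p = 0.
  apply: e_free; rewrite -/(addext (fun m (u : S) => rb u * e m) p).
  pose ev : {additive {malg S[Y]} -> A} := HB.pack (addext (fun m (u : S) => rb u * e m))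
    (GRing.isZmodMorphism.Build _ _ _ (addextB fB)).
  rewrite -[LHS]/(ev p) raddf_sum /=.
  under eq_bigr => k _ do rewrite (addextU fB).
  apply: (mulIf (lead_neq0 (redword w))); rewrite mul0r mulr_suml.
  have := congr1 (mcoeff w) h0; rewrite mcoeff0 coeff_Psi -/a => sum0.
  rewrite -[RHS]sum0 big_mkcond /= big_seq [RHS]big_seq; apply: eq_bigr => k ks.
  have kw : (ell k.2 <= ell w)%N.
    rewrite leqNgt; apply/negP => wk; have := IH k; move: ks.
    rewrite -mcoeff_neq0 => /eqP ks /(_ _)/ks; apply.
    by apply: leq_trans kN _; rewrite addnS -addSn leq_add2r.
  by rewrite coeff_Psi_basis //; case: ifP => _; rewrite ?mulr0 // mulrA.
have := congr1 (mcoeff l) p0; rewrite mcoeff0 raddf_sum /=.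
have [ks|/mcoeff_outdom ->//] := boolP ((l, w) \in msupp a).
rewrite big_mkcond (bigD1_seq (l, w)) ?fset_uniq //= eqxx mcoeffUU.
rewrite big1 ?addr0 // => -[l' w'] /= ne; case: eqP => // ww; rewrite mcoeffU.
by case: eqP => // ll; rewrite ll ww eqxx in ne.
Qed.

Section CoefficientSubring.
Context (P : A -> Prop).
Hypotheses (PD : forall f g : A, P f -> P g -> P (f + g)).
Hypotheses (PM : forall f g : A, P f -> P g -> P (f * g)).
Hypotheses (Pact : forall w (f : A), P f -> P (act w f)).
Hypotheses (Prb : forall a, P (rb a)) (Pe : forall l, P (e l)) (Pb : forall i, P (b i)).

Let P0 : P 0.
Proof. by rewrite -(rmorph0 rb). Qed.

Let coefP z := forall w, P (mcoeff w z).

Let coefPD y z : coefP y -> coefP z -> coefP (y + z).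
Proof. by move=> py pz w; rewrite mcoeffD; apply: PD. Qed.

Let coefPM y z : coefP y -> coefP z -> coefP (y * z).
Proof.
move=> py pz w; rewrite skcoeffM; elim/big_ind: _ => // g _.
by apply: PM => //; apply: Pact.
Qed.

Let coefP_mon (f : A) g : P f -> coefP (mon f g).
Proof. by move=> pf w; rewrite mcoeffU; case: eqP. Qed.

Lemma coeff_Psi_in h w : P (mcoeff w (Psi h)).
Proof.
have Pc i : P (c i).
  by rewrite -mulN1r -(rmorph1 rb) -rmorphN; apply: PD => //; apply: PM.
have PPsiH i : coefP (PsiH i) by apply: coefPD; apply: coefP_mon.
rewrite coeff_Psi; elim/big_ind: _ => // k _; apply: PM => //.
apply: coefPM; first exact: coefP_mon.
elim: (redword k.2) => [|i s IH]; first by apply: coefP_mon; rewrite -(rmorph1 rb).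
exact: coefPM.
Qed.
End CoefficientSubring.

(** The last clause says that the coefficients of [Phi h] lie in the smallest
subring that is stable under [act] and contains the scalars, the [e l] and the
[b i]. *)
Theorem principal_representation :
  exists Phi : {lrmorphism H -> skew},
  [/\ forall i, Phi (Hi i) = mon (c i) (r i) + mon (b i) 1%g,
      forall l, Phi (ZH l 1%g) = mon (e l) 1%g,
      injective Phi
    & forall P : A -> Prop,
        (forall f g : A, P f -> P g -> P (f + g)) ->
        (forall f g : A, P f -> P g -> P (f * g)) ->
        (forall w (f : A), P f -> P (act w f)) ->
        (forall a, P (rb a)) -> (forall l, P (e l)) -> (forall i, P (b i)) ->
        forall h w, P (mcoeff w (Phi h))].
Proof.
pose Phi : {lrmorphism H -> skew} := HB.pack (Psi : H -> skew)
  (GRing.isLinear.Build S H skew *:%R Psi (hext_linear Psi_basis))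
  (GRing.isMonoidMorphism.Build H skew Psi Psi_monoid).
exists Phi; split.
- exact: Psi_Hi.
- exact: Psi_Z.
- by apply: raddf_inj => h; apply: Psi_ker.
- by move=> P PD PM Pact Prb Pe Pb h w; apply: coeff_Psi_in.
Qed.
End PrincipalRepresentation.

(** * Fractions with sign-coherent denominators and their expansions *)

Section GeometricFractions.
Context (S : idomainType) (G : linordZmodType) (good : G -> Prop).
Hypothesis good_neq0 : forall y, good y -> y != 0.
Local Notation Z := (grpalg S G).
Local Notation K := {fraction Z}.
Local Notation "x %:F" := (FracField.tofrac x).
Local Notation ct a := (gconst G a : Z)%:F.
Local Notation ex y := (gmon 1 y : Z)%:F.

Definition den (s : seq G) : Z := \prod_(y <- s) (1 - gmon 1 y).

Lemma den_cat s t : den (s ++ t) = den s * den t.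
Proof. by rewrite /den big_cat. Qed.

Lemma den_cons y s : den (y :: s) = (1 - gmon 1 y) * den s.
Proof. exact: big_cons. Qed.

(** Fractions whose denominator is a product of [1 - e^y] with [good] exponents
[y]. *)
Definition geomfrac (f : K) := exists (p : Z) (s : seq G),
  (forall y, y \in s -> good y) /\ f = p%:F / (den s)%:F.

Lemma den_neq0 s : (forall y, y \in s -> good y) -> den s != 0.
Proof.
elim: s => [|y s IH] gs; first by rewrite /den big_nil oner_neq0.
rewrite /den big_cons mulf_neq0 ?one_sub_gmon_neq0 ?IH //.
  by apply/good_neq0/gs; rewrite inE eqxx.
by move=> z zs; apply: gs; rewrite inE zs orbT.
Qed.

Let good_cat (s t : seq G) : (forall y, y \in s -> good y) ->
  (forall y, y \in t -> good y) -> forall y, y \in s ++ t -> good y.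
Proof. by move=> gs gt y; rewrite mem_cat => /orP[/gs|/gt]. Qed.

Lemma geomfracD f g : geomfrac f -> geomfrac g -> geomfrac (f + g).
Proof.
move=> [p [s [gs ->]]] [q [t [gt ->]]].
exists (p * den t + q * den s), (s ++ t); split; first exact: good_cat.
have s0 := den_neq0 gs; have t0 := den_neq0 gt.
by rewrite addf_div ?tofrac_eq0 // den_cat -!tofracM -tofracD.
Qed.

Lemma geomfracM f g : geomfrac f -> geomfrac g -> geomfrac (f * g).
Proof.
move=> [p [s [gs ->]]] [q [t [gt ->]]].
exists (p * q), (s ++ t); split; first exact: good_cat.
by rewrite mulf_div den_cat -!tofracM.
Qed.

Lemma geomfrac_tofrac (p : Z) : geomfrac p%:F.
Proof. by exists p, [::]; split=> //; rewrite /den big_nil tofrac1 divr1. Qed.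

Lemma geomfrac_inv y : good y -> geomfrac (1 - ex y)^-1.
Proof.
move=> gy; exists 1, [:: y]; split; first by move=> z; rewrite inE => /eqP ->.
by rewrite /den big_seq1 -tofrac1 -tofracB tofrac1 div1r.
Qed.

Lemma geomfrac_b t u y : t \is a GRing.unit -> u \is a GRing.unit ->
  good (y + y) -> geomfrac (b_fun (ct t) (ct u) (ex y)).
Proof.
move=> tU uU gy; have ex2 : ex y ^+ 2 = ex (y + y) by rewrite exD expr2.
rewrite /b_fun ex2; apply: geomfracM; last exact: geomfrac_inv.
rewrite (ctV G tU) (ctV G uU) -!ctB.
have -> : ct (t - t^-1) + ct (u - u^-1) * ex y =
   (gconst G (t - t^-1) + gconst G (u - u^-1) * gmon 1 y)%:F.
  by rewrite tofracD tofracM.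
exact: geomfrac_tofrac.
Qed.

Lemma geomfrac_map (a : {additive G -> G}) (inj_a : injective (@grpalg_map S G G a)) f :
  (forall y, good y -> good (a y)) -> geomfrac f ->
  geomfrac (fracmap (@grpalg_map S G G a) f).
Proof.
move=> ga [p [s [gs ->]]]; exists (grpalg_map a p), (map a s); split.
  by move=> y /mapP[z /gs /ga gz ->].
rewrite fracmapE ?den_neq0 //; congr (_ / _%:F).
rewrite /den rmorph_prod big_map; apply: eq_bigr => y _.
by rewrite rmorphB rmorph1; congr (_ - _); exact: grpalg_map_gmon.
Qed.
End GeometricFractions.

Section Expansions.
Context (R : realType) (V : vectType R) (I : finType) (D : root_datum V I).
Context (L : coweight_lattice D).
Local Notation W := (weyl D).
Local Notation Y := (latY L).
Local Notation Zs := (Zsig L).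
Local Notation r := (sref D).
Implicit Types (w g h : W) (i j : I) (l m y : Y) (F : Y -> Zs).

Lemma latY_val_sum (n : I -> nat) :
  val (\sum_i coroot L i *+ n i) = \sum_i alphav D i *+ n i :> V.
Proof. by rewrite raddf_sum; apply: eq_bigr => i _; rewrite raddfMn. Qed.

Lemma latYMn_eq0 l n : (l *+ n.+1 == 0) = (l == 0).
Proof.
apply/eqP/eqP => [/(congr1 val)|->]; last by rewrite mul0rn.
rewrite raddfMn /= -scaler_nat => /eqP.
by rewrite scaler_eq0 pnatr_eq0 /= => /eqP l0; apply: val_inj.
Qed.

Lemma coroot_neq0 i : coroot L i != 0.
Proof. by apply/eqP => /(congr1 val) /eqP; rewrite (negbTE (av_neq0 D i)). Qed.

Lemma actY_faithful g h : (forall l, actY g l = actY h l) -> g = h.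
Proof.
by move=> gh; apply: weyl_coroot_inj => i; have := congr1 val (gh (coroot L i)).
Qed.

Lemma actYK w : cancel (@actY _ _ _ _ L w) (@actY _ _ _ _ L w^-1%g).
Proof. by move=> y; rewrite -actYM mulVg actY1. Qed.

Lemma actYVK w : cancel (@actY _ _ _ _ L w^-1%g) (@actY _ _ _ _ L w).
Proof. by move=> y; rewrite -actYM mulgV actY1. Qed.

Definition ycoef i (y : Y) : R := av_coef D i (val y).

Fact ycoef_zmod i : zmod_morphism (ycoef i).
Proof. by move=> x y; rewrite /ycoef /= linearB. Qed.
HB.instance Definition _ i := GRing.isZmodMorphism.Build Y R (ycoef i) (ycoef_zmod i).

Lemma ycoef_sum i (n : I -> nat) : ycoef i (\sum_j coroot L j *+ n j) = (n i)%:R.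
Proof. by rewrite /ycoef latY_val_sum av_coef_sum. Qed.

Lemma in_Qpos0 : in_Qpos (0 : Y).
Proof. by exists (fun=> 0%N); rewrite big1. Qed.

Lemma in_QposD x y : in_Qpos x -> in_Qpos y -> in_Qpos (x + y :> Y).
Proof.
move=> [m ->] [n ->]; exists (fun i => m i + n i)%N.
by rewrite -big_split /=; apply: eq_bigr => i _; rewrite mulrnDr.
Qed.

Lemma in_QposMn x n : in_Qpos x -> in_Qpos (x *+ n :> Y).
Proof. by move=> px; elim: n => [|n IH]; [exact: in_Qpos0|rewrite mulrS; apply: in_QposD]. Qed.

Lemma cone_supported_shift w F y : cone_supported w F ->
  cone_supported w (fun x => - F (x + y)).
Proof.
move=> [s Fs]; exists [seq mu - y | mu <- s] => x; rewrite oppr_eq0.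
move=> /Fs [mu [q [mus qpos xy]]]; exists (mu - y), q; split=> //.
  exact: map_f.
by rewrite addrAC -xy addrK.
Qed.

(** The series [G] is the sum over [n] of the translates [F (y + n w q)], that
is, the product of [F] with the geometric series of e^(- w q). At a given [y]
the sum is finite: if a translate is nonzero there, then [n] times a positive
coefficient of [q] is at most the same coefficient of [w^-1 (mu - y)], for one
of the finitely many apexes [mu] of the cones that contain the support of [F].
*)
Lemma geometric_series w F (q : Y) : in_Qpos q -> q != 0 -> cone_supported w F ->
  exists2 G, cone_supported w G & forall y, G y - G (y + actY w q) = F y.
Proof.
move=> qpos q0 [s Fs].
have [i qi] : exists i, 1 <= ycoef i q.
  case: qpos q0 => n ->; move=> /eqP q0; apply: contrapT => none; apply: q0.
  rewrite big1 // => i _; suff -> : n i = 0%N by [].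
  apply/eqP; rewrite -leqn0 leqNgt; apply/negP => ni; apply: none; exists i.
  by rewrite ycoef_sum ler1n.
pose N y := \max_(mu <- s) Num.bound (ycoef i (actY w^-1%g (mu - y)%R)).
have FN y n : (N y <= n)%N -> F (y + actY w q *+ n) = 0.
  move=> Nn; apply/eqP; apply: contraLR Nn => /Fs [mu [q' [mus [k q'E] yE]]].
  rewrite -ltnNge; apply: leq_trans (@leq_bigmax_seq Y s xpredT
    (fun mu => Num.bound (ycoef i (actY w^-1%g (mu - y)))) mu mus isT).
  have yE' : actY w^-1%g (mu - y) = q' + q *+ n.
    have -> : mu - y = actY w (q' + q *+ n).
      rewrite raddfD raddfMn /= -[y](addrK (actY w q *+ n)) yE.
      by rewrite !opprD !opprK !addrA subrr add0r.
    exact: actYK.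
  rewrite yE' -(ltr_nat R); apply: le_lt_trans (archi_boundP _).
    rewrite raddfD raddfMn /= q'E ycoef_sum; apply: ler_wpDl => //.
    exact: ler_wMn2r.
  rewrite raddfD raddfMn /= q'E ycoef_sum addr_ge0 // mulrn_wge0 //.
  exact: le_trans qi.
pose G y := \sum_(0 <= n < N y) F (y + actY w q *+ n).
have GM y M : (N y <= M)%N -> G y = \sum_(0 <= n < M) F (y + actY w q *+ n).
  move=> NM; rewrite (big_cat_nat _ NM) //= [X in _ + X]big_nat_cond.
  by rewrite [X in _ + X]big1 ?addr0 // => n /andP[/andP[/FN]].
exists G => [|y].
  exists s => y Gy; have [n Fn] : exists n, F (y + actY w q *+ n) != 0.
    apply: contrapT => none; move/eqP: Gy; apply; rewrite /G big1 // => n _.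
    by apply/eqP; apply: contrapT => /negP Fn; apply: none; exists n.
  have [mu [q' [mus q'pos e]]] := Fs _ Fn; exists mu, (q' + q *+ n); split=> //.
    exact/in_QposD/in_QposMn.
  by rewrite raddfD raddfMn /= opprD addrA -e addrK.
pose M := maxn (N y) (N (y + actY w q)).
rewrite (GM y M.+1) ?(GM (y + actY w q) M) ?leq_maxr //; last first.
  by rewrite leqW // leq_maxl.
rewrite big_nat_recl // mulr0n addr0.
under [X in _ + X - _]eq_bigr => n _ do rewrite mulrS addrA.
by rewrite addrK.
Qed.

(** Exponents [y] such that, for each [w], one of e^y and e^(- y) has a
geometric series supported in [- w Q^vee_+]. *)
Definition sign_coherent (y : Y) := forall w, exists q : Y,
  [/\ in_Qpos q, q != 0 & y = - actY w q \/ y = actY w q].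

Lemma sign_coherent_neq0 y : sign_coherent y -> y != 0.
Proof.
move=> /(_ 1%g) [q [_ q0]]; rewrite actY1 => -[->|->] //.
by rewrite oppr_eq0.
Qed.

Lemma sign_coherent_act g y : sign_coherent y -> sign_coherent (actY g y).
Proof.
move=> sy w; have [q [qpos q0 yq]] := sy (g^-1 * w)%g; exists q; split=> //.
by case: yq => ->; [left; rewrite raddfN /=|right]; rewrite -actYM mulgA mulgV mul1g.
Qed.

(** The denominator of [b_coroot L i] is [1 - e^y] for this [y], because
[b_fun] involves the square of its last argument. *)
Lemma sign_coherent_coroot2 i : sign_coherent (coroot L i + coroot L i).
Proof.
move=> w; rewrite -mulr2n.
have pos_lift (x : Y) : posc D (val x) -> in_Qpos x.
  by move=> [n xn]; exists n; apply: val_inj; rewrite latY_val_sum.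
have key (x : Y) : actY w x = coroot L i \/ actY w x = - coroot L i ->
    posc D (val x) -> exists q : Y,
    [/\ in_Qpos q, q != 0 & coroot L i *+ 2 = - actY w q \/ coroot L i *+ 2 = actY w q].
  move=> wx px; exists (x *+ 2); split.
  - exact/in_QposMn/pos_lift.
  - rewrite latYMn_eq0; apply/eqP => x0; have /eqP := coroot_neq0 i; apply.
    move: wx; rewrite x0 raddf0 => -[<- //|/esym/eqP].
    by rewrite oppr_eq0 => /eqP.
  - by rewrite raddfMn /=; case: wx => ->; [right|left]; rewrite // mulNrn opprK.
case: (sign_coherence w^-1%g i) => p.
- by apply: (key (actY w^-1%g (coroot L i))) => //; left; exact: actYVK.
- apply: (key (- actY w^-1%g (coroot L i))) => //; right.
  by rewrite raddfN /= actYVK.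
Qed.

Local Notation "x %:F" := (FracField.tofrac x).

(** Each factor of the denominator is inverted in turn. If its exponent is
positive for [w], then the geometric series of the opposite exponent is used: 1
/ (1 - e^c) = - e^(- c) / (1 - e^(- c)). *)
Lemma expansion_exists w (s : seq Y) (p : ZY L) :
  (forall y, y \in s -> sign_coherent y) ->
  exists2 F : Y -> Zs, cone_supported w F &
    forall y, mul_series (den Zs s) F y = gcoef y p.
Proof.
elim: s => [|c s IH] gs.
  exists (fun y => gcoef y p).
    exists (msupp p) => y py; exists y, 0; split.
    - by rewrite -mcoeff_neq0.
    - exact: in_Qpos0.
    - by rewrite raddf0 subr0.
  by move=> y; rewrite /den big_nil; apply: series_action1.
have [|F Fs FE] := IH; first by move=> y ys; apply: gs; rewrite inE ys orbT.
suff [G Gs GE] : exists2 G, cone_supported w G & forall y, G y - G (y - c) = F y.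
  exists G; first exact: Gs.
  move=> y; apply: etrans (FE y).
  apply: etrans (congr1 (fun p => series_action p G y) (den_cons Zs c s)) _.
  apply: etrans (series_action_step _ _ _ _) _.
  by apply: eq_bigr => x _; congr (_ * _); apply: GE.
have [q [qpos q0 [->|->]]] := gs c (mem_head c s) w.
  by have [G Gs GE] := geometric_series qpos q0 Fs; exists G => // y; rewrite opprK.
have [G Gs GE] := geometric_series qpos q0 Fs.
exists (fun y => - G (y + actY w q)); first exact: cone_supported_shift.
by move=> y; rewrite subrK opprK addrC; apply: GE.
Qed.

Lemma geomfrac_ZsY f : geomfrac sign_coherent f -> f \in ZsY L.
Proof.
move=> [p [s [gs fE]]]; apply/asboolP => w.
have [F Fs FE] := expansion_exists w p gs.
exists p, (den Zs s), F; split=> //.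
exact: den_neq0 sign_coherent_neq0 s gs.
Qed.

End Expansions.

(** * The embedding of the Hecke algebra *)

Theorem mainTheorem5 (R : realType) (V : vectType R) (I : finType)
    (D : root_datum V I) (L : coweight_lattice D)
    (H : algType (Zsig L)) (ZH : latY L -> weyl D -> H) (hH : BL_hecke ZH) :
  exists Psi : {lrmorphism H -> FYW L},
    [/\ forall h : H, Psi h \in ZsYW L,
        forall i : I, Psi (ZH 0 (sref D i)) =
          FYW_mon (c_coroot L i) (sref D i) + FYW_mon (b_coroot L i) 1%g,
        forall l : latY L, Psi (ZH l 1%g) = FYW_mon (expY (- l)) 1%g
      & injective Psi].
Proof.
case: hH => H_basis H_unity H_ZH H_up H_down H_ZZ H_HZ.
have indetU (x : I + I) : indet_var L x \is a GRing.unit.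
  apply/unitrPr; exists (gmon 1 (- [ffun k => (k == indet_class L x)%:R])).
  by rewrite gmonM mul1r subrr.
have sigmaU i : sigma L i \is a GRing.unit := indetU (inl i).
have sigmaU' i : sigma' L i \is a GRing.unit := indetU (inr i).
pose e (l : latY L) : FY L := expY (- l).
have e0 : e 0 = 1 by rewrite /e oppr0; exact: ex0.
have eD l m : e (l + m) = e l * e m by rewrite /e opprD; exact: exD.
have act_e w l : actFY L w (expY (- l)) = expY (- actY w l).
  rewrite -(raddfN (@actY _ _ _ _ L w)) /=.
  exact: etrans (actFY_tofrac w _) (congr1 _ (actZY_gmon w 1 (- l))).
have coroot2_neq0 i : coroot L i + coroot L i != 0.
  by rewrite -mulr2n latYMn_eq0 coroot_neq0.
have c_neq0 i : rbase (FY_action L) (sigma L i) - b_coroot L i != 0.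
  exact: (c_fun_neq0 (sigmaU i) (sigmaU' i) (coroot_neq0 L i) (coroot2_neq0 i)).
have sigma_mul i j : sigma L i * sigma L j + 1 != 0 by exact: gmon_mul_add1_neq0.
have H_HZ' i l : exists2 p : grpalg (Zsig L) (latY L),
    \sum_(m <- msupp p) rbase (FY_action L) (gcoef m p) * e m =
      b_coroot L i * (e l - e (actY (sref D i) l)) &
    ZH 0 (sref D i) * ZH l 1%g - ZH (actY (sref D i) l) 1%g * ZH 0 (sref D i) =
      \sum_(m <- msupp p) gcoef m p *: ZH m 1%g.
  have [p pE HZ] := H_HZ i l; exists p; last exact: HZ.
  exact: b_fun_inversion pE.
have [Psi [PsiH PsiZ Psi_inj Psi_coef]] :=
  @principal_representation R V I D (Zsig L) (FY L) (FY_action L) (latY L)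
    (@actY _ _ _ _ L) e (sigma L) (b_coroot L) H ZH e0 eD act_e (@actY_faithful _ _ _ _ L) (@ex_free _ _)
    sigmaU sigma_mul c_neq0 H_basis H_unity H_ZH H_up H_down H_ZZ H_HZ'.
exists Psi; split.
- move=> h; apply/asboolP => w; apply: geomfrac_ZsY.
  apply: (Psi_coef (geomfrac (@sign_coherent _ _ _ _ L))).
  + exact: geomfracD (@sign_coherent_neq0 _ _ _ _ L).
  + exact: geomfracM.
  + move=> v f; apply: (geomfrac_map (@sign_coherent_neq0 _ _ _ _ L) (@actZY_inj _ _ _ _ L v)).
    by move=> y; apply: sign_coherent_act.
  + by move=> a; exact: geomfrac_tofrac.
  + by move=> l; exact: geomfrac_tofrac.
  + move=> i; exact: (geomfrac_b (sigmaU i) (sigmaU' i) (sign_coherent_coroot2 L i)).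
- exact: PsiH.
- exact: PsiZ.
- exact: Psi_inj.
Qed.
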